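(* The power series $$\sum_{k\geq 0}\frac{H_k}{(2k)!}x^k$$ has radius of convergence $\pi^2$, where $H_k$ are the normalized limiting moments of the cotangent sums $c_0(r/b)$ defined in the context.
   Context: For coprime positive integers $r,b$, $b\ge 2$, let $c_0\left(\frac{r}{b}\right)=-\sum_{m=1}^{b-1}\frac{m}{b}\cot\left(\frac{\pi m r}{b}\right)$. Fix real numbers $A_0,A_1$ with $1/2<A_0<A_1<1$. For integers $k\ge 0$ define $$H_k=\lim_{b\to+\infty}\phi(b)^{-1}b^{-2k}(A_1-A_0)^{-1}\sum_{\substack{A_0b\leq r\leq A_1b\\ (r,b)=1}}c_0\left(\frac{r}{b}\right)^{2k},$$ where $\phi$ is the Euler phi-function. It is known from earlier work that these limits exist and that $H_k=\int_0^1\left(\frac{g(x)}{\pi}\right)^{2k}dx$, where $g(x)=\sum_{l\geq 1}\frac{1-2\{lx\}}{l}$ (the series converges for almost every $x\in(0,1)$) and $\{y\}$ denotes the fractional part of $y$. *)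

(* Defs.v *)
From mathcomp Require Import all_boot all_order all_algebra.
From mathcomp Require Import all_classical all_reals all_analysis.

Set Implicit Arguments.
Unset Strict Implicit.
Unset Printing Implicit Defensive.

Import Order.TTheory GRing.Theory Num.Theory.
Import numFieldNormedType.Exports.

Local Open Scope classical_set_scope.
Local Open Scope ring_scope.

Definition cot {R : realType} (x : R) : R := cos x / sin x.

(* c_0(r/b), as a function of the pair (r, b); it is only ever used for
   coprime r and b, i.e. for r/b in lowest terms. *)
Definition c0 {R : realType} (r b : nat) : R :=
  - \sum_(1 <= m < b) m%:R / b%:R * cot (pi * m%:R * r%:R / b%:R).

(* The bound r <= b only makes the index set finite: it is implied by
   r <= A1 * b as soon as A1 < 1. *)
Definition normalized_moment {R : realType} (A0 A1 : R) (k b : nat) : R :=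
  (totient b)%:R^-1 * b%:R ^- (2 * k) * (A1 - A0)^-1 *
  \sum_(0 <= r < b.+1 | (A0 * b%:R <= r%:R <= A1 * b%:R) && coprime r b)
     c0 r b ^+ (2 * k).

Definition convergence_radius {R : realType} (a : R^nat) : \bar R :=
  ereal_sup [set `|x|%:E | x in [set x : R | cvgn (pseries a x)]].

(* Main.v *)
Require Import Defs.
From mathcomp Require Import all_boot all_order all_algebra.
From mathcomp Require Import all_classical all_reals all_analysis.
From mathcomp Require Import zify ring lra.

Set Implicit Arguments.
Unset Strict Implicit.
Unset Printing Implicit Defensive.

Import Order.TTheory GRing.Theory Num.Theory.
Import numFieldNormedType.Exports.

Local Open Scope classical_set_scope.
Local Open Scope ring_scope.

(** If n is the inverse of r modulo b, then c_0(r/b) = (b/pi) S(n), where S(n)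
    is, up to a cut-off at m = b/2, the sum over m of
    (1 - 2{mn/b})/m; so c_0(r/b)/b behaves like g(n/b)/pi.  Near 0 the function
    g has the singularity log(1/x), and log(1/x) > t on a set of measure e^-t.
    The radius pi^2 says that no larger tail occurs: the moments of g of order
    2k grow like (2k)! up to factors (1 + o(1))^k.  Both halves are proved on
    the sums S(n) themselves, for suitable moduli b; since the limits H_k are
    given, the moduli can be chosen freely.

    Everything rests on one estimate, [cottail_mean_square]: the part T(n) of
    S(n) with m > L satisfies sum_n T(n)^2 <= C b L^(e-1) for every e > 0.
    Expanding the sawtooth in its finite Fourier series and applying Parseval
    bounds the left side by b times the sum of 1/(j m j' m') over
    j m = j' m' (mod b) with m, m' > L, and the divisor bound evaluates this.

    Upper bound ([limit_moment_le]).  Trivially |S - T| <= 1 + log L.  With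
    L = 2^i this gives |S(n)| <= 2 + i log 2 as soon as |T(n)| <= 1, and the
    exceptional n have proportion O(2^(-i(1-e))).  Hence exp(a|S|) has bounded
    mean for every a < 1, and so H_k <= C_a (2k)! (a pi)^(-2k).  Here b runs
    through the primes, where phi(b) is comparable with b.

    Lower bound ([limit_moment_ge]).  If n <= b/M, the head of S(n) is at least
    2 log M - log L - O(1), and choosing L = M^(1+h) up to a constant makes it
    (1-h) log M - O(1), while T is small for all but a small part of the n of this
    size.  It remains to see that
    a proportion of order 1/M of all n satisfies both n <= b/M and
    A0 b <= r <= A1 b, r being the inverse of n.  This is equidistribution of
    inverses, but it is only needed for some b in [B, 2B), and on average over
    b it is elementary: n r = 1 + j b with r/b close to j/n, so one counts
    coprime pairs (n, j) with j/n in [A0, A1] and, for each pair, the b in a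
    residue class modulo n.  The outcome is
    H_k >= c ((1-h) log M - K)^(2k) / (M pi^(2k)) for all k and all large M.

    For |x| < pi^2 the upper bound compares the series with a geometric one.
    For |x| > pi^2 boundedness of the terms and the lower bound would give
    exp(s) <= C M (1 + s) with s = (1+t) log M - O(1) and t > 0, which is false
    for large M. *)

(** * Finite trigonometric sums *)

Section trig_sums.
Variable R : realType.
Implicit Types (a b j n u v : nat) (x y : R).

Lemma sinD_npi x n : sin (x + pi *+ n) = (-1) ^+ n * sin x.
Proof. by rewrite (alternatingn (@sinDpi R)). Qed.

Lemma cosD_npi x n : cos (x + pi *+ n) = (-1) ^+ n * cos x.
Proof. by rewrite (alternatingn (@cosDpi R)). Qed.

Lemma cotD_npi x n : cot (x + pi *+ n) = cot x.
Proof.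
by rewrite /cot sinD_npi cosD_npi -mulf_div divff ?mul1r // signr_eq0.
Qed.

Lemma cotN x : cot (- x) = - cot x.
Proof. by rewrite /cot cosN sinN invrN mulrN. Qed.

Lemma pi_ratio_itv b j : (0 < j < b)%N -> 0 < (pi : R) * j%:R / b%:R < pi.
Proof.
move=> /andP[j0 jb]; have b0 : (0 : R) < b%:R by rewrite ltr0n; lia.
rewrite divr_gt0 ?mulr_gt0 ?pi_gt0 ?(ltr0n _ j) //=.
by rewrite ltr_pdivrMr // ltr_pM2l ?pi_gt0 // ltr_nat.
Qed.

Lemma sin_pi_ratio_gt0 b j : (0 < j < b)%N -> 0 < sin (pi * j%:R / b%:R) :> R.
Proof. by move=> jb; rewrite sin_gt0_pi // pi_ratio_itv. Qed.

Lemma pi_ratio_modn b a : (0 < b)%N ->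
  pi * a%:R / b%:R = pi * (a %% b)%:R / b%:R + pi *+ (a %/ b) :> R.
Proof.
move=> b0; rewrite {1}(divn_eq a b) natrD natrM mulrDr mulrDl addrC.
by congr (_ + _); rewrite mulrA mulfK ?pnatr_eq0 -?lt0n // mulr_natr.
Qed.

Lemma sin_pi_ratio_neq0 b a : (0 < b)%N -> ~~ (b %| a)%N ->
  sin (pi * a%:R / b%:R) != 0 :> R.
Proof.
move=> b0 nba; rewrite pi_ratio_modn // sinD_npi mulf_neq0 ?signr_eq0 //.
by rewrite gt_eqF // sin_pi_ratio_gt0 // ltn_mod b0 andbT lt0n.
Qed.

Lemma sum_cos_telescope x n :
  2 * sin (x / 2) * \sum_(j < n) cos (x * j%:R) =
  sin (x * n%:R - x / 2) + sin (x / 2).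
Proof.
elim: n => [|n IH]; first by rewrite big_ord0 !mulr0 sub0r sinN addNr.
rewrite big_ord_recr /= mulrDr IH.
have -> : x * n.+1%:R - x / 2 = x * n%:R + x / 2 by rewrite -natr1; field.
rewrite sinB sinD; ring.
Qed.

Lemma sum_cos_ndvd b a : (0 < b)%N -> ~~ (b %| a)%N ->
  \sum_(j < b) cos (pi *+ 2 * a%:R / b%:R * j%:R) = 0 :> R.
Proof.
move=> b0 nba; have bR : b%:R != 0 :> R by rewrite pnatr_eq0 -lt0n.
have := sum_cos_telescope (pi *+ 2 * a%:R / b%:R) b.
have -> : pi *+ 2 * a%:R / b%:R / 2 = pi * a%:R / b%:R :> R by rewrite mulr2n; field.
rewrite divfK //.
have -> : pi *+ 2 * a%:R - pi * a%:R / b%:R = - (pi * a%:R / b%:R) + pi *+ (2 * a) :> R.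
  by rewrite mulrnA -(mulr_natr (pi *+ 2)) addrC.
rewrite sinD_npi exprM sqrrN !expr1n mul1r sinN addNr => /eqP.
by rewrite mulf_eq0 mulf_eq0 pnatr_eq0 (negPf (sin_pi_ratio_neq0 b0 nba)) //= => /eqP.
Qed.

Lemma cos_dvd b a j : (b %| a)%N -> (0 < b)%N ->
  cos (pi *+ 2 * a%:R / b%:R * j%:R) = 1 :> R.
Proof.
move=> /dvdnP[q ->] b0; have bR : b%:R != 0 :> R by rewrite pnatr_eq0 -lt0n.
rewrite natrM mulrA mulfK // -mulrA -natrM mulr_natr -mulrnA.
by rewrite -[pi *+ _]add0r cosD_npi cos0 exprM sqrrN !expr1n mulr1.
Qed.

Lemma sum_cos b a : (0 < b)%N ->
  \sum_(j < b) cos (pi *+ 2 * a%:R / b%:R * j%:R) = (b%:R *+ (b %| a)%N) :> R.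
Proof.
move=> b0; have [ba|nba] := boolP (b %| a)%N; last by rewrite sum_cos_ndvd.
under eq_bigr do rewrite cos_dvd //.
by rewrite sumr_const card_ord.
Qed.

Lemma sin_mul_sin x y : sin x * sin y = (cos (x - y) - cos (x + y)) / 2.
Proof. by rewrite cosB cosD; field. Qed.

(** Only the upper bound is recorded: the product-to-sum formula also produces
    the term for u = - v modulo b, which has a negative sign. *)
Lemma sum_sin_sin_le b u v : (0 < b)%N ->
  \sum_(n < b) sin (pi *+ 2 * u%:R / b%:R * n%:R) * sin (pi *+ 2 * v%:R / b%:R * n%:R)
   <= (b%:R / 2) *+ (u == v %[mod b])%N :> R.
Proof.
move=> b0; wlog uv : u v / (v <= u)%N.
  move=> H; have [/H//|/ltnW/H] := leqP v u.
  by rewrite eq_sym; under eq_bigr do rewrite mulrC.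
have -> : (u == v %[mod b])%N = (b %| u - v)%N by rewrite eqn_mod_dvd.
have E (n : nat) : sin (pi *+ 2 * u%:R / b%:R * n%:R) * sin (pi *+ 2 * v%:R / b%:R * n%:R)
  = (cos (pi *+ 2 * (u - v)%:R / b%:R * n%:R)
     - cos (pi *+ 2 * (u + v)%:R / b%:R * n%:R)) / 2 :> R.
  by rewrite sin_mul_sin natrB // natrD; congr ((cos _ - cos _) / 2); ring.
rewrite (eq_bigr _ (fun (n : 'I_b) _ => E n)) -mulr_suml big_split /= sumrN !sum_cos //.
have : (0 : R) <= b%:R by [].
by case: (b %| u - v)%N; case: (b %| u + v)%N; rewrite /= ?mulr0n ?mulr1n; lra.
Qed.

End trig_sums.

(** * The dual form of the cotangent sum *)

Section cotangent_weights.
Variable R : realType.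
Implicit Types (a b j m n r : nat) (x y : R).

Lemma le_of_is_derive_ge0 (f df : R -> R) x y : x <= y ->
  (forall z : R, is_derive z (1 : R) f (df z)) -> (forall z, x <= z <= y -> 0 <= df z) ->
  f x <= f y.
Proof.
move=> xy fd df0.
have cf : {within `[x, y], continuous f}.
  apply: derivable_within_continuous => z _; exact: (@ex_derive _ _ _ _ _ _ _ (fd z)).
have [z zxy fz] := @MVT_segment R f df x y xy (fun z _ => fd z) cf.
by rewrite -subr_ge0 fz mulr_ge0 ?subr_ge0 // df0.
Qed.

Lemma sin_le_id x : 0 <= x -> sin x <= x.
Proof.
move=> x0; rewrite -subr_ge0.
have -> : 0 = 0 - sin 0 :> R by rewrite sin0 subr0.
apply: (@le_of_is_derive_ge0 (fun z => z - sin z) (fun z => 1 - cos z)) => //.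
Qed.

Lemma cos_ge_1B x : 0 <= x -> 1 - x <= cos x.
Proof.
move=> x0; rewrite -subr_ge0.
have -> : 0 = cos 0 - (1 - 0) :> R by rewrite cos0 subr0 subrr.
apply: (@le_of_is_derive_ge0 (fun z => cos z - (1 - z)) (fun z => - sin z - (0 - 1))) => //.
Qed.

Lemma x_cos_le_sin x : 0 <= x <= pi -> x * cos x <= sin x.
Proof.
move=> /andP[x0 xpi]; rewrite -subr_ge0.
have -> : 0 = sin 0 - 0 * cos 0 :> R by rewrite sin0 mul0r subr0.
apply: (@le_of_is_derive_ge0 (fun z => sin z - z * cos z)
  (fun z => cos z - (z *: - sin z + cos z *: 1))) => // z /andP[z0 zx].
rewrite /GRing.scale /= mulr1 mulrN opprD opprK addrCA subrr addr0.
by rewrite mulr_ge0 // sin_ge0_pi // z0 (le_trans zx).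
Qed.

(** The cotangent weight is cut off at b/2: the terms m and b - m of the
    cotangent sums below agree, so half of the range determines the sum, and
    there the weight is nonnegative and at most 1/m. *)
Definition wt b m : R :=
  if (0 < m)%N && (m.*2 < b)%N then pi / b%:R * cot (pi * m%:R / b%:R) else 0.

Lemma cos_pi_ratio_gt0 b m : (m.*2 < b)%N -> 0 < cos (pi * m%:R / b%:R) :> R.
Proof.
move=> mb; have b0R : 0 < b%:R :> R by rewrite ltr0n; lia.
have p0 := pi_gt0 R.
apply: cos_gt0_pihalf; apply/andP; split.
  apply: (@lt_le_trans _ _ 0); first by rewrite oppr_lt0 divr_gt0.
  by rewrite divr_ge0 // mulr_ge0 // ltW.
rewrite -mulrA ltr_pM2l // ltr_pdivrMr //.
have : (m.*2)%:R < b%:R :> R by rewrite ltr_nat.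
by rewrite -muln2 natrM; lra.
Qed.

(** With x = pi m / b these are the inequalities 1 - x <= x cot x <= 1. *)
Lemma wt_bounds b m : (0 < m)%N -> (m.*2 < b)%N ->
  m%:R^-1 - pi / b%:R <= wt b m <= m%:R^-1.
Proof.
move=> m0 mb; rewrite /wt m0 mb /=.
have m0R : 0 < m%:R :> R by rewrite ltr0n.
have b0R : 0 < b%:R :> R by rewrite ltr0n; lia.
set x := pi * m%:R / b%:R.
have /andP[x0 xpi] : 0 < x < pi by apply: pi_ratio_itv; lia.
have sx : 0 < sin x by rewrite sin_gt0_pi // x0.
have -> : pi / b%:R = x / m%:R by rewrite /x; field; rewrite !gt_eqF.
have -> : x / m%:R * cot x = x * cos x / sin x / m%:R.
  by rewrite /cot; field; rewrite !gt_eqF.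
have -> : m%:R^-1 - x / m%:R = (1 - x) / m%:R by ring.
suff /andP[h1 h2] : 1 - x <= x * cos x / sin x <= 1.
  by rewrite ler_pM2r ?invr_gt0 // h1 ler_piMl ?invr_ge0 // ltW.
have xc : x * cos x <= sin x by apply: x_cos_le_sin; rewrite !ltW.
rewrite ler_pdivlMr // ler_pdivrMr // mul1r xc andbT.
have c := cos_ge_1B (ltW x0); have s := sin_le_id (ltW x0).
have [x1|x1] := leP x 1; last first.
  (* For x > 1 the left side is negative and cos x is positive since m < b/2. *)
  have [c0|c0] := leP 0 (cos x).
    by apply: (@le_trans _ _ 0); [rewrite mulr_le0_ge0 ?ltW // subr_lt0|exact: mulr_ge0 (ltW x0) c0].
  by have := cos_pi_ratio_gt0 mb; rewrite -/x; lra.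
apply: (@le_trans _ _ ((1 - x) * x)); first by rewrite ler_wpM2l // subr_ge0.
by rewrite mulrC ler_pM2l.
Qed.

Lemma wt_out b m : ~~ ((0 < m) && (m.*2 < b))%N -> wt b m = 0.
Proof. by rewrite /wt => /negPf ->. Qed.

Lemma wt_le b m : wt b m <= m%:R^-1.
Proof.
have [/andP[m0 mb]|/wt_out->] := boolP ((0 < m) && (m.*2 < b))%N.
  by case/andP: (wt_bounds m0 mb).
by rewrite invr_ge0.
Qed.

Lemma wt_ge0 b m : 0 <= wt b m.
Proof.
have [/andP[m0 mb]|/wt_out->//] := boolP ((0 < m) && (m.*2 < b))%N.
rewrite /wt m0 mb /=.
have b0R : 0 < b%:R :> R by rewrite ltr0n; lia.
apply: mulr_ge0; first by rewrite divr_ge0 ?pi_ge0.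
apply/ltW/divr_gt0; first exact: cos_pi_ratio_gt0.
by apply: sin_pi_ratio_gt0; lia.
Qed.

Lemma cot_pi_refl b m : (0 < m < b)%N ->
  cot (pi * (b - m)%:R / b%:R) = - cot (pi * m%:R / b%:R) :> R.
Proof.
move=> mb; rewrite -cotN -[RHS](cotD_npi _ 1) natrB; last by lia.
have b0R : b%:R != 0 :> R by rewrite pnatr_eq0; lia.
by congr cot; rewrite mulrBr mulrBl mulfK // addrC.
Qed.

(** The terms m and b - m coincide, and the fixed point m = b/2 contributes 0. *)
Lemma fold_half b (F : nat -> R) :
  (forall m, (0 < m < b)%N -> F (b - m)%N = F m) ->
  (forall m, m.*2 = b -> F m = 0) ->
  \sum_(1 <= m < b) F m = 2 * \sum_(1 <= m < b | (m.*2 < b)%N) F m.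
Proof.
move=> Fr F0; rewrite (bigID (fun m => (m.*2 < b)%N)) /= mulr_natl mulr2n; congr (_ + _).
rewrite big_nat_rev /= [RHS]big_nat_cond [LHS]big_nat_cond.
rewrite (bigID (fun m => m.*2 == b)) /= big1 ?add0r => [|m /andP[/andP[mb _] /eqP E]]; last first.
  by apply: F0; lia.
apply: congr_big => // m; first by lia.
by move=> mb; rewrite -[RHS]Fr; [congr F|]; lia.
Qed.

Lemma fold_cot b (f : nat -> R) :
  (forall m, (0 < m < b)%N -> f (b - m)%N = - f m) ->
  \sum_(1 <= m < b) cot (pi * m%:R / b%:R) * f m
  = 2 * b%:R / pi * \sum_(m < b) wt b m * f m.
Proof.
move=> fr; have [->|b0] := posnP b; first by rewrite big_nil // mulr0 !mul0r.
rewrite fold_half; first last.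
- move=> m mb; have : f m = - f m by rewrite -fr; [congr f|]; lia.
  by move=> /eqP; rewrite -addr_eq0 -mulr2n mulrn_eq0 /= => /eqP->; rewrite mulr0.
- by move=> m mb; rewrite cot_pi_refl // fr // mulrNN.
have b0R : b%:R != 0 :> R by rewrite pnatr_eq0; lia.
have p0 : pi != 0 :> R by rewrite gt_eqF // pi_gt0.
rewrite -[2 * b%:R / pi]mulrA -[RHS]mulrA; congr (2 * _); rewrite mulr_sumr.
rewrite -(big_mkord xpredT (fun m => b%:R / pi * (wt b m * f m))).
rewrite big_ltn // wt_out // mul0r mulr0 add0r big_mkcond /=.
apply: eq_big_nat => m /andP[m0 mb]; rewrite /wt m0 /=.
case: ifP => _; last by rewrite mul0r mulr0.
by rewrite !mulrA; congr (_ * _ * _); move: p0; generalize (pi : R) => q q0; field; rewrite b0R q0.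
Qed.

(** The sawtooth 1 - 2{a/b}, normalised to 0 at the multiples of b so that it
    is odd and equal to its Fourier series everywhere. *)
Definition saw b a : R := if (b %| a)%N then 0 else 1 - 2 * (a %% b)%:R / b%:R.

Lemma saw_modn b a : saw b (a %% b) = saw b a.
Proof. by rewrite /saw modn_mod /dvdn modn_mod. Qed.

Lemma norm_saw_le1 b a : `|saw b a| <= 1.
Proof.
rewrite /saw; case: ifPn => [_|ba]; first by rewrite normr0.
have [b0|b0] := posnP b.
  by rewrite b0 invr0 mulr0 subr0 normr1.
have b0R : 0 < b%:R :> R by rewrite ltr0n.
have : (a %% b)%:R / b%:R <= 1 :> R.
  by rewrite ler_pdivrMr // mul1r ler_nat ltnW // ltn_mod.
have : 0 <= (a %% b)%:R / b%:R :> R by rewrite divr_ge0.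
rewrite -mulrA; set t := _ / _ => t0 t1; rewrite ler_norml; apply/andP; split; lra.
Qed.

Lemma modn_oppn b a a' : (0 < b)%N -> (b %| a + a')%N -> ~~ (b %| a)%N ->
  (a' %% b = b - a %% b)%N.
Proof.
move=> b0 /dvdnP[q E] ba.
have := divn_eq a b; have := divn_eq a' b; have := ltn_pmod a b0; have := ltn_pmod a' b0.
have : (0 < a %% b)%N by rewrite lt0n.
set s := (a %% b)%N; set s' := (a' %% b)%N; set t := (a %/ b)%N; set t' := (a' %/ b)%N.
move=> h1 h2 h3 h4 h5; have : (s + s' + (t + t') * b = q * b)%N by lia.
move=> h; have : (q = (t + t').+1)%N by nia.
by move=> qE; move: h; rewrite qE; nia.
Qed.

Lemma saw_opp b a a' : (0 < b)%N -> (b %| a + a')%N -> saw b a' = - saw b a.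
Proof.
move=> b0 E; rewrite /saw.
have -> : (b %| a')%N = (b %| a)%N.
  by apply/idP/idP => h; [rewrite -(dvdn_addl _ h)|rewrite -(dvdn_addr _ h)].
case: ifPn => ba; first by rewrite oppr0.
rewrite (modn_oppn b0 E ba) natrB; last by rewrite ltnW // ltn_mod.
have b0R : b%:R != 0 :> R by rewrite pnatr_eq0 -lt0n.
by field.
Qed.

Lemma cot_sin_diff x y : sin y != 0 ->
  cot y * (sin (x + y) - sin (x - y)) = cos (x + y) + cos (x - y).
Proof. by move=> sy; rewrite sinB sinD cosB cosD /cot; field. Qed.

(** Consecutive values of the Fourier series of the sawtooth differ by full sums
    of cosines, because cot t (sin(x + t) - sin(x - t)) = cos(x + t) + cos(x - t). *)
Lemma saw_step b a j : (0 < j < b)%N ->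
  cot (pi * j%:R / b%:R) * (sin (pi *+ 2 * a.+1%:R / b%:R * j%:R)
     - sin (pi *+ 2 * a%:R / b%:R * j%:R))
  = cos (pi *+ 2 * a.+1%:R / b%:R * j%:R) + cos (pi *+ 2 * a%:R / b%:R * j%:R) :> R.
Proof.
move=> jb; set t : R := pi * j%:R / b%:R; have st := sin_pi_ratio_gt0 R jb.
pose x : R := pi *+ 2 * a%:R / b%:R * j%:R + t.
have -> : pi *+ 2 * a.+1%:R / b%:R * j%:R = x + t.
  by rewrite /x /t -natr1; move: (pi : R) => q; ring.
have -> : pi *+ 2 * a%:R / b%:R * j%:R = x - t by rewrite /x addrK.
by rewrite cot_sin_diff // gt_eqF.
Qed.

(** The left side vanishes at a = 0 and, by [saw_step] and the evaluation of
    cosine sums, jumps by b - 2 from 0 to 1 and then decreases by 2 at each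
    step below b. *)
Lemma saw_cot b a : (0 < b)%N ->
  \sum_(1 <= j < b) cot (pi * j%:R / b%:R) * sin (pi *+ 2 * a%:R / b%:R * j%:R)
  = b%:R * saw b a.
Proof.
move=> b0; have b0R : b%:R != 0 :> R by rewrite pnatr_eq0 -lt0n.
pose F a' : R := \sum_(1 <= j < b) cot (pi * j%:R / b%:R) * sin (pi *+ 2 * a'%:R / b%:R * j%:R).
rewrite -/(F a).
have F0 : F 0%N = 0.
  by rewrite /F big1 // => j _; rewrite mulr0 !mul0r sin0 mulr0.
have FS a' : F a'.+1 = F a' + (b%:R *+ (b %| a'.+1)%N + b%:R *+ (b %| a')%N - 2).
  rewrite -!sum_cos // -big_split /= addrC; apply/eqP; rewrite -subr_eq; apply/eqP.
  rewrite /F -sumrB; under eq_big_nat => j jb do rewrite -mulrBr saw_step //.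
  rewrite -(big_mkord xpredT (fun j => cos (pi *+ 2 * a'.+1%:R / b%:R * j%:R) + cos (pi *+ 2 * a'%:R / b%:R * j%:R))).
  by rewrite [in RHS]big_ltn // !mulr0 cos0 addrAC subrr add0r.
have Fsm : forall a', (a' < b)%N -> F a' = b%:R * saw b a'.
  elim=> [_|a' IH ab]; first by rewrite F0 /saw dvdn0 mulr0.
  rewrite FS IH; last by lia.
  have nS : (b %| a'.+1)%N = false by rewrite gtnNdvd.
  rewrite /saw nS (modn_small ab) mulr0n.
  have [->|a0] := posnP a'; first by rewrite dvdn0 /= mulr1n; field.
  have -> : (b %| a')%N = false by rewrite gtnNdvd //; lia.
  rewrite modn_small; last by lia.
  by rewrite -natr1 /= mulr0n; field.
have Fper : forall a' q, F (a' + q * b)%N = F a'.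
  move=> a' q; apply: eq_bigr => j _; congr (_ * _).
  have -> : pi *+ 2 * (a' + q * b)%:R / b%:R * j%:R = pi *+ 2 * a'%:R / b%:R * j%:R + pi *+ (2 * (q * j)) :> R.
    by rewrite -[pi *+ (2 * _)]mulr_natr -[pi *+ 2]mulr_natr !natrM natrD natrM; move: (pi : R) => q'; field.
  by rewrite sinD_npi exprM sqrrN !expr1n mul1r.
by rewrite (divn_eq a b) addnC Fper Fsm ?ltn_mod // -[in RHS]saw_modn -modnDmr modnMl addn0 modn_mod saw_modn.
Qed.

Lemma saw_fourier b a : (0 < b)%N ->
  saw b a = 2 / pi * \sum_(j < b) wt b j * sin (pi *+ 2 * a%:R / b%:R * j%:R).
Proof.
move=> b0; have b0R : b%:R != 0 :> R by rewrite pnatr_eq0 -lt0n.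
apply: (mulfI b0R); rewrite -saw_cot // fold_cot; first by rewrite !mulrA (mulrC b%:R).
move=> j jb; have -> : pi *+ 2 * a%:R / b%:R * (b - j)%:R = - (pi *+ 2 * a%:R / b%:R * j%:R) + pi *+ (2 * a) :> R.
  rewrite natrB; last by lia.
  by rewrite mulrBr divfK // addrC mulrnA mulr_natr.
by rewrite sinD_npi exprM sqrrN !expr1n mul1r sinN.
Qed.

(** A discrete version of g(n/b), where g(x) is the sum of (1 - 2{mx})/m. *)
Definition cotsum b n : R := \sum_(m < b) wt b m * saw b (m * n).

Lemma cot_modn b a : (0 < b)%N ->
  cot (pi * (a %% b)%:R / b%:R) = cot (pi * a%:R / b%:R) :> R.
Proof. by move=> b0; rewrite (pi_ratio_modn R a b0) cotD_npi. Qed.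

(** Replacing the summation index m by m n modulo b moves the arithmetic from the
    cotangent to the linear factor, which becomes the fractional part {mn/b};
    oddness of the cotangent then turns it into the sawtooth. *)
Lemma c0_cotsum b n r : (1 < b)%N -> (n * r = 1 %[mod b])%N ->
  c0 r b = b%:R / pi * cotsum b n :> R.
Proof.
move=> b1 nr; have b0 : (0 < b)%N by lia.
have b0R : b%:R != 0 :> R by rewrite pnatr_eq0; lia.
have p0 : pi != 0 :> R by rewrite gt_eqF // pi_gt0.
have cop : coprime b n.
  by have := coprimen1 b; rewrite -coprime_modr -nr coprime_modr coprimeMr => /andP[].
pose G m : R := (m %% b)%:R / b%:R * cot (pi * (m * r)%:R / b%:R).
have Gmod m : G (m %% b)%N = G m.
  by rewrite /G modn_mod -cot_modn // modnMml cot_modn.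
have GE : \sum_(1 <= m < b) m%:R / b%:R * cot (pi * m%:R * r%:R / b%:R) = \sum_(m < b) G m :> R.
  rewrite -(big_mkord xpredT G) [RHS]big_ltn // {1}/G mod0n !mul0r add0r.
  by apply: eq_big_nat => m /andP[_ mb]; rewrite /G modn_small // natrM mulrA.
have h_inj : injective (fun m : 'I_b => Ordinal (ltn_pmod (m * n) b0)).
  have K m : ((m * n) %% b * r = m %[mod b])%N.
    by rewrite modnMml -mulnA -modnMmr nr modnMmr muln1.
  move=> m m' /(congr1 val) /= E; apply/val_inj => /=.
  by rewrite -(modn_small (ltn_ord m)) -K E K modn_small.
rewrite /c0 GE (reindex_inj h_inj) /=.
have GmE (m : nat) : G ((m * n) %% b)%N = ((m * n) %% b)%:R / b%:R * cot (pi * m%:R / b%:R).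
  rewrite Gmod /G; congr (_ * _).
  by rewrite -cot_modn // -mulnA -modnMmr nr modnMmr muln1 cot_modn.
rewrite (eq_bigr _ (fun (m : 'I_b) _ => GmE m)).
rewrite -(big_mkord xpredT (fun m => ((m * n) %% b)%:R / b%:R * cot (pi * m%:R / b%:R))).
rewrite big_ltn // mul0n mod0n !mul0r add0r.
set X := \sum_(1 <= m < b) _.
have ndvd m : (0 < m < b)%N -> ~~ (b %| m * n)%N.
  by move=> mb; rewrite Gauss_dvdl // gtnNdvd //; lia.
have opp m : (0 < m < b)%N -> (b %| m * n + (b - m) * n)%N.
  by move=> mb; rewrite -mulnDl subnKC ?dvdn_mulr //; lia.
(* X is averaged with its reflection under m -> b - m. *)
have XE : 2 * X = - \sum_(1 <= m < b) cot (pi * m%:R / b%:R) * saw b (m * n).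
  rewrite mulr_natl mulr2n {1}/X big_nat_rev -big_split /= -sumrN.
  apply: eq_big_nat => m mb.
  have -> : (1 + b - m.+1 = b - m)%N by lia.
  rewrite cot_pi_refl // (modn_oppn b0 (opp _ mb) (ndvd _ mb)) /saw (negPf (ndvd _ mb)).
  rewrite natrB; last by rewrite ltnW // ltn_mod.
  by field.
have -> : - X = 2^-1 * - (2 * X) by field.
rewrite XE opprK fold_cot; last by move=> m mb; rewrite (saw_opp b0 (opp _ mb)).
by rewrite /cotsum; move: p0; generalize (pi : R) => q q0; field; rewrite q0.
Qed.

End cotangent_weights.

(** * The divisor bound *)

Section divisor_bound.
Variable R : realType.
Local Notation tau n := (size (divisors n)).

(** Every divisor d of u v is gcd(d, u) times a divisor of v. *)
Lemma size_divisorsM u v : (0 < u)%N -> (0 < v)%N ->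
  (tau (u * v) <= tau u * tau v)%N.
Proof.
move=> u0 v0; rewrite -(size_allpairs muln); apply: uniq_leq_size; first exact: divisors_uniq.
move=> d; rewrite -dvdn_divisors ?muln_gt0 ?u0 // => duv.
have d0 : (0 < d)%N by apply: dvdn_gt0 duv; rewrite muln_gt0 u0.
apply/allpairsP; exists (gcdn d u, d %/ gcdn d u)%N => /=.
have g0 : (0 < gcdn d u)%N by rewrite gcdn_gt0 d0.
split; first by rewrite -dvdn_divisors // dvdn_gcdr.
- rewrite -dvdn_divisors // -(@Gauss_dvdr _ (u %/ gcdn d u)).
    rewrite -(dvdn_pmul2l g0) !mulnA.
    have E1 : (gcdn d u * (d %/ gcdn d u) = d)%N by rewrite mulnC divnK ?dvdn_gcdl.
    have E2 : (gcdn d u * (u %/ gcdn d u) = u)%N by rewrite mulnC divnK ?dvdn_gcdr.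
    by rewrite E1 E2.
  rewrite /coprime -(eqn_pmul2l g0) muln_gcdr muln1 mulnC divnK ?dvdn_gcdl //.
  by rewrite mulnC divnK ?dvdn_gcdr.
- by rewrite mulnC divnK ?dvdn_gcdl.
Qed.

Lemma size_divisors_pfactor p a : prime p -> (tau (p ^ a) <= a.+1)%N.
Proof.
move=> pp; have <- : size (map (expn p) (iota 0 a.+1)) = a.+1 by rewrite size_map size_iota.
apply: uniq_leq_size; first exact: divisors_uniq.
move=> d; rewrite -dvdn_divisors ?expn_gt0 ?prime_gt0 // => /(dvdn_pfactor _ _ pp)[m ma ->].
by apply: map_f; rewrite mem_iota.
Qed.

Lemma succ_le_exp2 (e : R) : 0 < e ->
  exists2 K : R, 1 <= K & forall a : nat, a.+1%:R <= K * 2 `^ (a%:R * e).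
Proof.
move=> e0; have l2 : 0 < ln 2 :> R by rewrite ln_gt0 // ltr1n.
have el : 0 < e * ln 2 by rewrite mulr_gt0.
exists (1 + (e * ln 2)^-1); first by rewrite lerDl invr_ge0 ltW.
move=> a; have a0 : 0 <= a%:R :> R by [].
apply: (@le_trans _ _ ((1 + (e * ln 2)^-1) * (1 + a%:R * (e * ln 2)))); last first.
  rewrite ler_pM2l; last by rewrite ltr_pwDl // invr_ge0 ltW.
  by rewrite /powR pnatr_eq0 /= mulrA expR_ge1Dx.
have i0 : 0 < (e * ln 2)^-1 by rewrite invr_gt0.
have -> : (1 + (e * ln 2)^-1) * (1 + a%:R * (e * ln 2)) =
  1 + a%:R + (a%:R * (e * ln 2) + (e * ln 2)^-1).
  by field; rewrite !gt_eqF.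
by rewrite -natr1 [a%:R + 1]addrC lerDl addr_ge0 ?(ltW i0) // mulr_ge0 // ltW.
Qed.

(** For primes p with p^e >= 2 each prime factor, counted with multiplicity, at
    most doubles the number of divisors and multiplies n^e by at least 2. *)
Lemma tau_rough (e : R) (P n : nat) : 0 <= e -> 2 <= P%:R `^ e -> (0 < n)%N ->
  (forall p, prime p -> (p %| n)%N -> (P <= p)%N) -> (tau n)%:R <= n%:R `^ e.
Proof.
move=> e0 P2; have [k] := ubnP n; elim: k n => // k IH n nk n0 pP.
have [->|n1] := eqVneq n 1%N; first by rewrite powR1.
have ngt1 : (1 < n)%N by lia.
have [p pp pn] := pdivP ngt1.
have p1 := prime_gt1 pp.
move: (pn) => /dvdnP[q nE]; have q0 : (0 < q)%N by move: n0; rewrite nE muln_gt0 => /andP[].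
have tq : (tau q)%:R <= q%:R `^ e.
  apply: IH => //; first by rewrite nE in nk; nia.
  by move=> p' pp' p'q; apply: pP => //; rewrite nE dvdn_mulr.
apply: (@le_trans _ _ ((tau q)%:R * 2)).
  rewrite -natrM ler_nat nE (leq_trans (size_divisorsM q0 (prime_gt0 pp))) //.
  by rewrite leq_mul2l -{1}(expn1 p) (size_divisors_pfactor 1 pp) orbT.
rewrite nE natrM powRM // ler_pM //.
by apply: (le_trans P2); rewrite ge0_ler_powR ?nnegrE // ler_nat pP.
Qed.

(** The primes below P are removed one at a time: extracting
    s^a costs a + 1 <= K 2^(a e) <= K s^(a e), that is, one factor K.  When
    P - j - 1 is not a prime, the hypothesis for j + 1 already gives the one
    for j. *)
Lemma tau_smooth_step (e K : R) (P j n : nat) : 0 <= e -> 2 <= P%:R `^ e ->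
  1 <= K -> (forall a : nat, a.+1%:R <= K * 2 `^ (a%:R * e)) -> (0 < n)%N ->
  (forall p, prime p -> (p %| n)%N -> (P - j <= p)%N) ->
  (tau n)%:R <= K ^+ j * n%:R `^ e.
Proof.
move=> e0 P2 K1 Ka; elim: j n => [|j IH] n n0 pP.
  rewrite mul1r; apply: tau_rough P2 _ _ => // p pp pn; by rewrite -(subn0 P) pP.
have K0 : 0 <= K by rewrite (le_trans _ K1).
set s := (P - j.+1)%N.
have [/andP[ps sP]|ns] := boolP (prime s && (j < P)%N); last first.
  apply: (@le_trans _ _ (K ^+ j * n%:R `^ e)).
    apply: IH => // p pp pn; have := pP p pp pn; rewrite -/s => sp.
    have [E|] := eqVneq s p; last by rewrite /s in sp *; lia.
    by move: ns; rewrite E pp /=; lia.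
  by rewrite exprS ler_wpM2r ?powR_ge0 // ler_peMl // exprn_ge0.
have [m sm nE] := pfactor_coprime ps n0.
set a := logn s n in nE.
have m0 : (0 < m)%N by move: n0; rewrite nE muln_gt0 => /andP[].
have sa0 : (0 < s ^ a)%N by rewrite expn_gt0 prime_gt0.
apply: (@le_trans _ _ ((tau m)%:R * a.+1%:R)).
  rewrite -natrM ler_nat nE (leq_trans (size_divisorsM m0 sa0)) //.
  by rewrite leq_mul2l size_divisors_pfactor // orbT.
rewrite nE natrM powRM // exprS [K * _]mulrC mulrACA; apply: ler_pM => //.
  apply: IH => // p pp pm.
  have : (s <= p)%N by apply: pP => //; rewrite nE dvdn_mulr.
  have [E|] := eqVneq s p; last by rewrite /s; lia.
  by move: sm; rewrite prime_coprime // E pm.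
apply: (le_trans (Ka a)); rewrite ler_pM2l ?(lt_le_trans ltr01) //.
rewrite natrX -powR_mulrn // -powRrM.
by rewrite ge0_ler_powR ?nnegrE ?mulr_ge0 // ler_nat prime_gt1.
Qed.

Lemma divisor_bound (e : R) : 0 < e ->
  exists2 C : R, 0 < C & forall n, (0 < n)%N -> (tau n)%:R <= C * n%:R `^ e.
Proof.
move=> e0; have [K K1 Ka] := succ_le_exp2 e0.
pose P := (Num.truncn (2 `^ e^-1 : R)).+1.
have P2 : 2 <= P%:R `^ e.
  have -> : 2 = (2 `^ e^-1) `^ e :> R by rewrite -powRrM mulVf ?gt_eqF // powRr1.
  rewrite ge0_ler_powR ?nnegrE ?powR_ge0 ?ltW //.
  exact: truncnS_gt.
exists (K ^+ P); first by rewrite exprn_gt0 // (lt_le_trans ltr01).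
move=> n n0; apply: (tau_smooth_step (ltW e0) P2 K1 Ka n0) => p _ _; lia.
Qed.

End divisor_bound.

(** * Parseval for the tail, and sums of powers *)

Section mean_square.
Variable R : realType.
Local Notation wt := (@wt R).

Definition cottail b L n : R := \sum_(m < b | (L < m)%N) wt b m * saw R b (m * n).

(** The coefficient of the frequency c in the sine expansion of [cottail], up to
    the factor 2/pi. *)
Definition residue_mass b L c : R :=
  \sum_(p : 'I_b * 'I_b | (L < p.1)%N && (p.1 * p.2 == c %[mod b])%N)
    wt b p.1 * wt b p.2.

Lemma cottail_sines b L n : (0 < b)%N ->
  cottail b L n = 2 / pi * \sum_(p : 'I_b * 'I_b | (L < p.1)%N)
    wt b p.1 * wt b p.2 * sin (pi *+ 2 * (p.1 * p.2)%:R / b%:R * n%:R).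
Proof.
move=> b0; rewrite /cottail; under [in RHS]eq_bigl => p do rewrite -[(L < p.1)%N]andbT.
rewrite -(pair_big_dep (fun m : 'I_b => (L < m)%N) (fun _ _ => true)
  (fun m j : 'I_b => wt b m * wt b j * sin (pi *+ 2 * (m * j)%:R / b%:R * n%:R))) /=.
rewrite mulr_sumr; apply: eq_bigr => m _.
rewrite saw_fourier // mulrCA mulr_sumr; congr (_ * _); apply: eq_bigr => j _.
by rewrite mulrA; congr (_ * sin _); rewrite !natrM; move: (pi : R) => q; ring.
Qed.

(** The numerical factor (2/pi)^2 / 2 is at most 1.  All weights are nonnegative,
    so the one-sided orthogonality relation [sum_sin_sin_le] suffices. *)
Lemma cottail_parseval b L : (0 < b)%N ->
  \sum_(n < b) cottail b L n ^+ 2 <= b%:R * \sum_(c < b) residue_mass b L c ^+ 2.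
Proof.
move=> b0; have b0R : 0 < b%:R :> R by rewrite ltr0n.
pose w (p : 'I_b * 'I_b) : R := wt b p.1 * wt b p.2.
have w0 p : 0 <= w p by rewrite mulr_ge0 // wt_ge0.
pose V (p : 'I_b * 'I_b) := (p.1 * p.2)%N.
pose s v n : R := sin (pi *+ 2 * v%:R / b%:R * n%:R).
pose P (p : 'I_b * 'I_b) := (L < p.1)%N.
pose D : R := \sum_(p | P p) \sum_(q | P q) (w p * w q) *+ (V p == V q %[mod b])%N.
have D0 : 0 <= D.
  by apply: sumr_ge0 => p _; apply: sumr_ge0 => q _; rewrite mulrn_wge0 // mulr_ge0.
have -> : \sum_(c < b) residue_mass b L c ^+ 2 = D.
  have E c : residue_mass b L c ^+ 2 = \sum_(p | P p) \sum_(q | P q)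
      (w p * w q) *+ ((V p == c %[mod b])%N && (V q == c %[mod b])%N).
    rewrite expr2 /residue_mass big_mkcondr /= mulr_suml; apply: eq_bigr => p _.
    rewrite mulr_sumr; apply: eq_bigr => q _.
    by rewrite -/(V p) -/(V q) /w; case: eqP; case: eqP; rewrite /= ?mulr0 ?mul0r.
  rewrite (eq_bigr _ (fun (c : 'I_b) _ => E c)) exchange_big; apply: eq_bigr => p _.
  rewrite exchange_big; apply: eq_bigr => q _ /=.
  rewrite (bigD1 (Ordinal (ltn_pmod (V p) b0))) //= modn_mod eqxx /= eq_sym.
  rewrite big1 ?addr0 // => c /eqP nc; case: eqP => //= cE; case: nc; apply: val_inj => /=.
  by rewrite cE modn_small.
have TE n : cottail b L n ^+ 2 = (2 / pi) ^+ 2 *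
    \sum_(p | P p) \sum_(q | P q) (w p * w q) * (s (V p) n * s (V q) n).
  rewrite cottail_sines // exprMn; congr (_ * _); rewrite expr2 mulr_suml.
  apply: eq_bigr => p _; rewrite mulr_sumr; apply: eq_bigr => q _; rewrite /w /s; exact: mulrACA.
rewrite (eq_bigr _ (fun (n : 'I_b) _ => TE n)) -mulr_sumr.
apply: (@le_trans _ _ ((2 / pi) ^+ 2 * (b%:R / 2 * D))).
  rewrite ler_wpM2l ?sqr_ge0 // exchange_big mulr_sumr; apply: ler_sum => p _.
  rewrite exchange_big mulr_sumr; apply: ler_sum => q _ /=; rewrite -mulr_sumr.
  have ww : 0 <= w p * w q by rewrite mulr_ge0.
  apply: (le_trans (ler_wpM2l ww (sum_sin_sin_le R (V p) (V q) b0))).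
  by rewrite !mulrnAr mulrC.
have p2 := pi_ge2 R; have p0 := pi_gt0 R.
have h : (2 / pi) ^+ 2 <= 1 :> R.
  by rewrite exprn_ile1 ?divr_ge0 ?pi_ge0 // ler_pdivrMr ?mul1r.
rewrite mulrA ler_wpM2r //; apply: (@le_trans _ _ (1 * (b%:R / 2))).
  by rewrite ler_wpM2r ?divr_ge0.
by rewrite mul1r; lra.
Qed.

Lemma le_ln_succ n : (0 < n)%N -> n.+1%:R^-1 <= ln n.+1%:R - ln n%:R :> R.
Proof.
move=> n0; have n0R : 0 < n%:R :> R by rewrite ltr0n.
have := @le_ln1Dx R (- n.+1%:R^-1).
have -> : 1 + - n.+1%:R^-1 = n%:R / n.+1%:R :> R by rewrite -natr1; field; rewrite natr1.
rewrite ln_div ?posrE // ltrN2 invf_lt1 // ltr1n => /(_ n0).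
by rewrite lerNr opprB.
Qed.

Lemma ln_succ_le n : (0 < n)%N -> ln n.+1%:R - ln n%:R <= n%:R^-1 :> R.
Proof.
move=> n0; have n0R : 0 < n%:R :> R by rewrite ltr0n.
have := @le_ln1Dx R n%:R^-1.
have -> : 1 + n%:R^-1 = n.+1%:R / n%:R :> R by rewrite -natr1; field; rewrite gt_eqF.
by rewrite ln_div ?posrE //; apply; rewrite (@lt_trans _ _ 0) // invr_gt0.
Qed.

Lemma harmonic_le n : (0 < n)%N -> \sum_(1 <= i < n.+1) i%:R^-1 <= 1 + ln n%:R :> R.
Proof.
elim: n => // -[|n] IH _; first by rewrite big_nat1 ln1 addr0 invr1.
rewrite big_nat_recr //=; apply: (le_trans (lerD (IH isT) (le_ln_succ (ltn0Sn n)))).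
by rewrite -addrA [_ + (_ - _)]addrC subrK.
Qed.

Lemma harmonic_ge n : (0 < n)%N -> ln n%:R <= \sum_(1 <= i < n.+1) i%:R^-1 :> R.
Proof.
suff H m : ln m.+1%:R <= \sum_(1 <= i < m.+1) i%:R^-1 :> R.
  case: n => // n _; apply: (le_trans (H n)); rewrite [leRHS]big_nat_recr //= lerDl.
  by rewrite invr_ge0.
elim: m => [|m IH]; first by rewrite big_nil ln1.
rewrite big_nat_recr //=; apply: (le_trans _ (lerD IH (ln_succ_le (ltn0Sn m)))).
by rewrite [_ + (_ - _)]addrC subrK.
Qed.

(** By (1 - 1/x)^(-B) >= exp(B/x) >= 1 + B/x at x = n + 1; it makes the tail sum
    below telescope. *)
Lemma powR_diff_ge (B : R) n : 0 < B -> (0 < n)%N ->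
  B * n.+1%:R `^ (- B - 1) <= n%:R `^ (- B) - n.+1%:R `^ (- B).
Proof.
move=> B0 n0; have n0R : 0 < n%:R :> R by rewrite ltr0n.
rewrite powRB; last by rewrite pnatr_eq0 implybT.
rewrite powRr1 //.
have n1 : 0 < n.+1%:R `^ (- B) :> R by rewrite powR_gt0.
have -> : n%:R `^ (- B) = n.+1%:R `^ (- B) * expR (B * (ln n.+1%:R - ln n%:R)) :> R.
  rewrite /powR !gt_eqF // -expRD; congr expR; ring.
have := expR_ge1Dx (B * (ln n.+1%:R - ln n%:R)).
have : B * n.+1%:R^-1 <= B * (ln n.+1%:R - ln n%:R) by rewrite ler_pM2l // le_ln_succ.
set E := expR _; set l := B * (_ - _) => h1 h2.
set z := n.+1%:R `^ _ in n1 *.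
have -> : B * (z / n.+1%:R) = z * (B * n.+1%:R^-1) by rewrite mulrCA.
have -> : z * E - z = z * (E - 1) by rewrite mulrBr mulr1.
by rewrite ler_pM2l // lerBrDl; apply: le_trans h2; rewrite lerD2l.
Qed.

Lemma powR_tail_le (B : R) L n : 0 < B -> (0 < L)%N ->
  \sum_(L.+1 <= c < n) c%:R `^ (- B - 1) <= L%:R `^ (- B) / B.
Proof.
move=> B0 L0; rewrite ler_pdivlMr //.
have [nL|Ln] := leqP n L.+1; first by rewrite big_geq // mul0r powR_ge0.
suff H k : (\sum_(L.+1 <= c < (k + L).+1) c%:R `^ (- B - 1)) * B
    <= L%:R `^ (- B) - (k + L)%:R `^ (- B).
  have -> : n = ((n - L.+1) + L).+1 by lia.
  by apply: (le_trans (H _)); rewrite gerBl powR_ge0.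
elim: k => [|k IH]; first by rewrite big_geq // mul0r subrr.
rewrite addSn big_nat_recr /=; last by lia.
have h : (0 < k + L)%N by lia.
rewrite mulrDl [X in _ + X]mulrC; apply: (le_trans (lerD IH (powR_diff_ge B0 h))).
by rewrite addrA subrK.
Qed.

End mean_square.

(** * Mean square of the tail *)

Section tail_bound.
Variable R : realType.
Local Notation wt := (@wt R).
Local Notation tau n := (size (divisors n)).

Definition product_mass b L v : R :=
  \sum_(p : 'I_b * 'I_b | (L < p.1)%N && (p.1 * p.2 == v)%N) wt b p.1 * wt b p.2.

Lemma product_mass_small b L v : (v <= L)%N -> product_mass b L v = 0.
Proof.
move=> vL; apply: big1 => -[m j] /= /andP[Lm /eqP E].
have -> : j = 0%N :> nat by nia.
by rewrite [wt b 0]wt_out // mulr0.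
Qed.

Lemma product_mass_le b L v : (0 < v)%N -> product_mass b L v <= (tau v)%:R / v%:R.
Proof.
move=> v0; pose d (p : 'I_b * 'I_b) := nat_of_ord p.1.
pose Q := [pred p : 'I_b * 'I_b | (p.1 * p.2 == v)%N].
apply: (@le_trans _ _ (\sum_(p | Q p) v%:R^-1)).
  rewrite /product_mass big_mkcond [leRHS]big_mkcond /=; apply: ler_sum => p _.
  case: (eqVneq (p.1 * p.2)%N v) => [<-|_]; last by rewrite andbF.
  rewrite andbT natrM invfM; case: ifP => _; last by rewrite mulr_ge0 // invr_ge0.
  by rewrite ler_pM ?wt_ge0 ?wt_le.
rewrite sumr_const -[leLHS]mulr_natl ler_wpM2r ?invr_ge0 // ler_nat.
rewrite cardE -(size_map d); apply: uniq_leq_size.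
  rewrite map_inj_in_uniq ?enum_uniq // => -[m j] [m' j']; rewrite !mem_enum /d /=.
  move=> /eqP /= E /eqP /= E' mm'; have jj' : j = j' :> nat.
    by apply/eqP; rewrite -(@eqn_pmul2l m) ?E ?mm' ?E' //; nia.
  by congr pair; apply: val_inj.
move=> x /mapP[p]; rewrite mem_enum => /eqP /= E ->.
by rewrite -dvdn_divisors // -E dvdn_mulr.
Qed.

Lemma residue_mass_split b L (c : 'I_b) :
  residue_mass R b L c = \sum_(i < b) product_mass b L (i * b + c)%N.
Proof.
have b0 : (0 < b)%N by apply: leq_ltn_trans (ltn_ord c).
have lt_b (p : 'I_b * 'I_b) : (p.1 * p.2 %/ b < b)%N by rewrite ltn_divLR // ltn_mul.
rewrite /residue_mass (partition_big (fun p => Ordinal (lt_b p)) predT) //=.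
apply: eq_bigr => i _; apply: eq_bigl => p; rewrite -andbA; congr (_ && _).
apply/andP/eqP => [[/eqP E /eqP/(congr1 val) /= F]|E].
  by rewrite (divn_eq (p.1 * p.2) b) F E modn_small.
split; first by rewrite E modnMDl.
by apply/eqP/val_inj; rewrite /= E divnMDl // divn_small ?addn0.
Qed.

Lemma one_add_ln_le (e : R) n : 0 < e <= 1 -> (0 < n)%N -> 1 + ln n%:R <= n%:R `^ e / e.
Proof.
move=> /andP[e0 e1] n0; have n0R : 0 < n%:R :> R by rewrite ltr0n.
rewrite ler_pdivlMr // /powR gt_eqF //.
have h := expR_ge1Dx (e * ln n%:R); apply: le_trans h; rewrite mulrDl mul1r.
by rewrite [ln _ * _]mulrC lerD2r.
Qed.

Lemma powRB1 (x : R) n : (0 < n)%N -> n%:R `^ (x - 1) = n%:R `^ x / n%:R.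
Proof.
by move=> n0; rewrite powRB ?powRr1 // pnatr_eq0 -lt0n n0 implybT.
Qed.

(** Write a product v = i b + c.  The term i = 0 is the single value v = c, which
    occurs only for c > L; the terms i >= 1 are at most C b^(2e) / (i b) each,
    so together they are at most C b^(3e-1) / e, which is negligible. *)
Lemma residue_mass_le (e C : R) b L (c : 'I_b) : 0 < e <= 1 -> 0 < C ->
  (forall n, (0 < n)%N -> (tau n)%:R <= C * n%:R `^ e) ->
  residue_mass R b L c <=
    C * ((if (L < c)%N then c%:R `^ (e - 1) else 0) + b%:R `^ (e *+ 3 - 1) / e).
Proof.
move=> /andP[e0 e1] C0 tauC.
have b0 : (0 < b)%N by apply: leq_ltn_trans (ltn_ord c).
have b0R : 0 < b%:R :> R by rewrite ltr0n.
have PM v : (0 < v)%N -> product_mass b L v <= C * v%:R `^ (e - 1).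
  move=> v0; apply: (le_trans (product_mass_le b L v0)).
  by rewrite powRB1 // mulrA ler_pM2r ?invr_gt0 ?ltr0n // tauC.
rewrite residue_mass_split -(big_mkord xpredT (fun i => product_mass b L (i * b + c)%N)).
rewrite big_ltn // mul0n add0n mulrDr; apply: lerD.
  case: ltnP => [Lc|cL]; last by rewrite product_mass_small // mulr0.
  by apply: PM; lia.
apply: (@le_trans _ _ (\sum_(1 <= i < b) C * (b%:R `^ (e *+ 2 - 1)) * i%:R^-1)).
  rewrite big_nat_cond [leRHS]big_nat_cond; apply: ler_sum => i; rewrite andbT => /andP[i0 ib].
  have v0 : (0 < i * b + c)%N by rewrite addn_gt0 muln_gt0 i0 b0.
  apply: (le_trans (PM _ v0)); rewrite -mulrA ler_pM2l //.
  have i0R : 0 < i%:R :> R by rewrite ltr0n.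
  rewrite !powRB1 // -mulrA -invfM -natrM.
  apply: ler_pM; rewrite ?powR_ge0 ?invr_ge0 //.
    rewrite -(mulr_natl e 2) powRrM powR_mulrn // ge0_ler_powR ?nnegrE ?exprn_ge0 ?(ltW e0) //.
    by rewrite -natrX ler_nat; have := ltn_ord c; nia.
  rewrite lef_pV2 ?posrE ?ltr0n ?muln_gt0 ?b0 //.
  by rewrite ler_nat mulnC leq_addr.
rewrite -mulr_sumr -mulrA ler_pM2l //.
have hb : \sum_(1 <= i < b) i%:R^-1 <= b%:R `^ e / e :> R.
  apply: le_trans (one_add_ln_le _ b0); last by rewrite e0.
  apply: le_trans (harmonic_le R b0).
  by rewrite [leRHS]big_nat_recr //= lerDl invr_ge0.
apply: (le_trans (ler_wpM2l (powR_ge0 _ _) hb)).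
rewrite mulrA -powRD; last by rewrite pnatr_eq0 -lt0n b0 implybT.
by rewrite (_ : e *+ 2 - 1 + e = e *+ 3 - 1) //; rewrite !mulrS; ring.
Qed.

(** For L < b the contribution of the products v = c is the tail of the sum of
    c^(2d-2), of size L^(2d-1), and the wrapped-around products contribute
    b^(6d-1), which is at most L^(6d-1); hence the choice d = e/6.  For
    L >= b the tail is empty. *)
Lemma cottail_mean_square (e : R) : 0 < e < 1 ->
  exists2 C : R, 0 < C & forall b L, (0 < L)%N ->
    \sum_(n < b) cottail R b L n ^+ 2 <= C * b%:R * L%:R `^ (e - 1).
Proof.
move=> /andP[e0 e1]; pose d := e / 6.
have d0 : 0 < d by rewrite divr_gt0.
have d1 : d < 6^-1 by rewrite /d; lra.
have [C C0 tauC] := divisor_bound d0.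
pose B := 1 - d *+ 2; have B0 : 0 < B by rewrite /B mulr2n; lra.
pose K := 2 * C ^+ 2 * (B^-1 + d ^- 2).
have K0 : 0 < K.
  apply: mulr_gt0; first by apply: mulr_gt0 => //; exact: exprn_gt0.
  by apply: addr_gt0; rewrite invr_gt0 // exprn_gt0.
exists K => // b L L0.
have [bL|Lb] := leqP b L.
  rewrite big1 => [|n _].
    by apply: mulr_ge0; [exact: mulr_ge0 (ltW K0) _|exact: powR_ge0].
  by rewrite /cottail big1 ?expr0n // => m; have := ltn_ord m; lia.
have b0 : (0 < b)%N by lia.
have b0R : 0 < b%:R :> R by rewrite ltr0n.
have L0R : 0 < L%:R :> R by rewrite ltr0n.
have L1R : 1 <= L%:R :> R by rewrite ler1n.
apply: (le_trans (cottail_parseval R L b0)).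
rewrite [K * _]mulrC -mulrA ler_pM2l //.
pose y : R := b%:R `^ (d *+ 3 - 1) / d.
pose x c : R := if (L < c)%N then c%:R `^ (d - 1) else 0.
apply: (@le_trans _ _ (\sum_(c < b) 2 * C ^+ 2 * (x c ^+ 2 + y ^+ 2))).
  apply: ler_sum => c _.
  have r0 : 0 <= residue_mass R b L c by apply: sumr_ge0 => p _; rewrite mulr_ge0 // wt_ge0.
  have dd : 0 < d <= 1 by rewrite d0; lra.
  have h := residue_mass_le L c dd C0 tauC; rewrite -/(x c) -/y in h.
  apply: (@le_trans _ _ ((C * (x c + y)) ^+ 2)).
    by rewrite ler_sqr ?nnegrE // (le_trans r0).
  rewrite exprMn [2 * _]mulrC -[leRHS]mulrA ler_pM2l; last exact: exprn_gt0.
  by have := sqr_ge0 (x c - y); rewrite !expr2; lra.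
rewrite -mulr_sumr /K -[leRHS]mulrA ler_pM2l; last by apply: mulr_gt0 => //; exact: exprn_gt0.
rewrite big_split /= mulrDl; apply: lerD.
  have -> : \sum_(c < b) x c ^+ 2 = \sum_(L.+1 <= c < b) c%:R `^ (- B - 1).
    rewrite big_geq_mkord [RHS]big_mkcond /=; apply: eq_bigr => c _; rewrite /x.
    case: ltnP => _; last by rewrite expr0n.
    rewrite -powR_mulrn ?powR_ge0 // -powRrM; congr (_ `^ _); rewrite /B; ring.
  apply: (le_trans (powR_tail_le b B0 L0)); rewrite mulrC ler_pM2l ?invr_gt0 //.
  by apply: ler_powR => //; rewrite /B /d; lra.
rewrite sumr_const card_ord /y expr_div_n -mulrnAl mulrC ler_pM2l ?invr_gt0 ?exprn_gt0 //.
have -> : (b%:R `^ (d *+ 3 - 1)) ^+ 2 *+ b = b%:R `^ (e - 1) :> R.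
  rewrite -mulr_natr -powR_mulrn ?powR_ge0 // -powRrM -[X in _ * X = _](powRr1 (ltW b0R)).
  rewrite -powRD; last by rewrite (gt_eqF b0R) implybT.
  by congr (_ `^ _); rewrite /d !mulrS; field.
rewrite -(opprB 1 e) !powRN lef_pV2 ?posrE ?powR_gt0 //.
by rewrite ge0_ler_powR ?nnegrE ?subr_ge0 ?(ltW e1) // ler_nat ltnW.
Qed.

End tail_bound.

(** * Exponential moments of the cotangent sums *)

Section exponential_moment.
Variable R : realType.
Local Notation wt := (@wt R).
Local Notation cotsum := (@cotsum R).
Local Notation cottail := (@cottail R).

Lemma cotsum_split b L n : cotsum b n =
  \sum_(m < b | (m <= L)%N) wt b m * saw R b (m * n) + cottail b L n.
Proof.
rewrite /cotsum (bigID (fun m : 'I_b => (m <= L)%N)) /=; congr (_ + _).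
by apply: eq_bigl => m; rewrite -ltnNge.
Qed.

Lemma sum_inv_ord_le b L :
  \sum_(m < b | (m <= L)%N) m%:R^-1 <= \sum_(1 <= m < L.+1) m%:R^-1 :> R.
Proof.
rewrite -(big_mkord (fun m => (m <= L)%N) (fun m => m%:R^-1)).
have -> : \sum_(1 <= m < L.+1) m%:R^-1 = \sum_(0 <= m < L.+1) m%:R^-1 :> R.
  by rewrite [RHS]big_ltn // invr0 add0r.
rewrite (big_nat_widen _ _ (maxn b L.+1)) ?leq_maxl //.
rewrite [leRHS](big_nat_widen _ _ (maxn b L.+1)) ?leq_maxr //.
rewrite big_mkcond [leRHS]big_mkcond; apply: ler_sum => m _ /=; rewrite ltnS.
by case: (m <= L)%N => //=; case: ifP => // _; rewrite invr_ge0.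
Qed.

Lemma norm_cothead_le b L n : (0 < L)%N ->
  `|cotsum b n - cottail b L n| <= 1 + ln L%:R.
Proof.
move=> L0; rewrite (cotsum_split b L) addrK.
apply: le_trans (ler_norm_sum _ _ _) _; apply: le_trans (harmonic_le R L0).
apply: le_trans (sum_inv_ord_le b L); apply: ler_sum => m _.
rewrite normrM (ger0_norm (wt_ge0 _ _ _)).
by rewrite -[leRHS]mulr1 ler_pM ?wt_ge0 ?wt_le ?norm_saw_le1.
Qed.

Lemma cottail_ge b L n : (b <= L)%N -> cottail b L n = 0.
Proof. by move=> bL; rewrite /cottail big1 // => m; have := ltn_ord m; lia. Qed.

(** Take the first i with |T| <= 1 for the cut-off 2^i; then |S| <= 2 + i log 2.
    If i > 0, the previous tail exceeds 1, so multiplying by its square only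
    increases the bound.  The sum over i stands for the unknown index. *)
Lemma exp_cotsum_le (a : R) b n : 0 <= a ->
  expR (a * `|cotsum b n|) <= expR (a * 2) +
    \sum_(i < b) expR (a * (2 + i.+1%:R * ln 2)) * cottail b (2 ^ i) n ^+ 2.
Proof.
move=> a0; pose ok i := `|cottail b (2 ^ i) n| <= 1.
have okb : exists i, ok i.
  by exists b; rewrite /ok cottail_ge ?normr0 // ltnW // ltn_expl.
have bnd i : ok i -> `|cotsum b n| <= 2 + i%:R * ln 2.
  move=> oki; rewrite -[cotsum b n](subrK (cottail b (2 ^ i) n)).
  apply: (le_trans (ler_normD _ _)).
  have i2 : (0 < 2 ^ i)%N by rewrite expn_gt0.
  have := norm_cothead_le b n i2; rewrite natrX lnXn // mulr_natl => h.
  by have := lerD h oki; rewrite addrAC.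
have pos : 0 <= \sum_(i < b) expR (a * (2 + i.+1%:R * ln 2)) * cottail b (2 ^ i) n ^+ 2.
  by apply: sumr_ge0 => i _; rewrite mulr_ge0 ?expR_ge0 ?sqr_ge0.
case: (ex_minnP okb) => -[|i] oki mini.
  apply: (@le_trans _ _ (expR (a * 2))); last by rewrite lerDl.
  by rewrite ler_expR ler_wpM2l //; have := bnd _ oki; rewrite mul0r addr0.
have nok : 1 < `|cottail b (2 ^ i) n|.
  by rewrite ltNge; apply/negP => h; have := mini i h; rewrite ltnn.
have ib : (i < b)%N.
  rewrite ltnNge; apply/negP => bi; move: nok; rewrite cottail_ge ?normr0 ?ltr10 //.
  by apply: leq_trans bi _; rewrite ltnW // ltn_expl.
apply: (@le_trans _ _ (expR (a * (2 + i.+1%:R * ln 2)) * cottail b (2 ^ i) n ^+ 2)).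
  rewrite -[leLHS]mulr1; apply: ler_pM; rewrite ?expR_ge0 //.
    by rewrite ler_expR ler_wpM2l // bnd.
  by rewrite -real_normK ?num_real // exprn_ege1 // ltW.
rewrite (bigD1 (Ordinal ib)) //= addrCA lerDl addr_ge0 ?expR_ge0 //.
by apply: sumr_ge0 => j _; rewrite mulr_ge0 ?expR_ge0 ?sqr_ge0.
Qed.

Lemma geometric_sum_le (q : R) n : 0 <= q < 1 -> \sum_(i < n) q ^+ i <= (1 - q)^-1.
Proof.
move=> /andP[q0 q1]; have q10 : 0 < 1 - q by rewrite subr_gt0.
rewrite -[leRHS]mul1r ler_pdivlMr // mulrC -[1 - q]opprB mulNr -subrX1 opprB.
by rewrite gerBl exprn_ge0.
Qed.

(** Averaging the previous bound with the mean square estimate leaves the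
    geometric series of 2^(i(a + e - 1)), and a + e < 1 for e = (1 - a)/2. *)
Lemma exp_moment (a : R) : 0 < a < 1 ->
  exists2 C : R, 0 < C & forall b, \sum_(n < b) expR (a * `|cotsum b n|) <= C * b%:R.
Proof.
move=> /andP[a0 a1]; pose e := (1 - a) / 2.
have e01 : 0 < e < 1 by rewrite /e; apply/andP; split; lra.
have [C C0 HC] := cottail_mean_square e01.
have l2 : 0 < ln 2 :> R by rewrite ln_gt0 // ltr1n.
pose q := expR (- (ln 2 * e)).
have q1 : q < 1 by rewrite expR_lt1 oppr_lt0 mulr_gt0 //; case/andP: e01.
have q0 : 0 < q by apply: expR_gt0.
pose E := expR (a * (2 + ln 2)).
have E0 : 0 < E by apply: expR_gt0.
exists (expR (a * 2) + E * C / (1 - q)) => [|b].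
  by rewrite addr_gt0 ?expR_gt0 // divr_gt0 ?subr_gt0 // mulr_gt0.
have b0 : 0 <= b%:R :> R by [].
apply: (@le_trans _ _ (\sum_(n < b) (expR (a * 2) +
    \sum_(i < b) expR (a * (2 + i.+1%:R * ln 2)) * cottail b (2 ^ i) n ^+ 2))).
  by apply: ler_sum => n _; exact: exp_cotsum_le (ltW a0).
rewrite big_split /= sumr_const card_ord -[expR _ *+ b]mulr_natr [leRHS]mulrDl lerD2l exchange_big /=.
apply: (@le_trans _ _ (\sum_(i < b) E * C * b%:R * q ^+ i)).
  apply: ler_sum => i _; rewrite -mulr_sumr.
  have i2 : (0 < 2 ^ i)%N by rewrite expn_gt0.
  apply: (le_trans (ler_wpM2l (expR_ge0 _) (HC b _ i2))).
  have XP : expR (a * (2 + i.+1%:R * ln 2)) * (2 ^ i)%:R `^ (e - 1) = E * q ^+ i.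
    rewrite /q /E -expRM_natl /powR natrX gt_eqF ?exprn_gt0 // lnXn // -!expRD.
    by congr expR; rewrite -mulr_natl -natr1 /e; field.
  by rewrite mulrCA XP le_eqVlt; apply/orP; left; apply/eqP; rewrite mulrC mulrA; ring.
rewrite -mulr_sumr [leRHS]mulrAC ler_wpM2l //.
  by apply: mulr_ge0 => //; apply: mulr_ge0; exact: ltW.
by apply: geometric_sum_le; rewrite q1 ltW.
Qed.

Lemma even_pow_le_expR (y : R) k : y ^+ (2 * k) <= (2 * k)`!%:R * expR `|y|.
Proof.
have f0 : 0 < (2 * k)`!%:R :> R by rewrite ltr0n fact_gt0.
rewrite -ler_pdivrMl // mulrC.
have -> : y ^+ (2 * k) = `|y| ^+ (2 * k).
  by rewrite !exprM real_normK // num_real.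
case: k f0 => [|k] f0; first last.
  apply: le_trans (expR_ge1Dxn (2 * k).+1 (normr_ge0 y)).
  by rewrite mulnS addSn add1n lerDr.
by rewrite muln0 expr0 fact0 divr1 (le_trans _ (expR_ge1Dx _)) // lerDl.
Qed.

Lemma cotsum_moment (a : R) : 0 < a < 1 ->
  exists2 C : R, 0 < C & forall b k,
    \sum_(n < b) cotsum b n ^+ (2 * k) <= C * b%:R * (2 * k)`!%:R / a ^+ (2 * k).
Proof.
move=> a01; have [C C0 HC] := exp_moment a01; have /andP[a0 _] := a01.
exists C => // b k; rewrite ler_pdivlMr ?exprn_gt0 // mulr_suml.
apply: (@le_trans _ _ (\sum_(n < b) (2 * k)`!%:R * expR (a * `|cotsum b n|))).
  apply: ler_sum => n _; rewrite -exprMn mulrC.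
  by apply: le_trans (even_pow_le_expR _ _) _; rewrite normrM (gtr0_norm a0).
by rewrite -mulr_sumr mulrC ler_pM2r ?ltr0n ?fact_gt0.
Qed.

End exponential_moment.

(** * From sums over residues to the limiting moments *)

Section moments.
Variable R : realType.
Local Notation cotsum := (@cotsum R).

Definition invmod b r := ((egcdn r b).1 %% b)%N.

Lemma invmodP b r : (1 < b)%N -> coprime r b -> (invmod b r * r = 1 %[mod b])%N.
Proof.
move=> b1 rb; have r0 : (0 < r)%N.
  by rewrite lt0n; apply: contraTneq rb => ->; rewrite /coprime gcd0n; lia.
rewrite /invmod modnMml; case: egcdnP => // u v E _.
by rewrite E (eqP rb) modnMDl.
Qed.

Lemma invmod_lt b r : (0 < b)%N -> (invmod b r < b)%N.
Proof. by move=> b0; rewrite ltn_mod. Qed.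

Lemma coprime_of_inv b r s : (r * s = 1 %[mod b])%N -> coprime r b.
Proof.
move=> rs; rewrite coprime_sym.
by have := coprimen1 b; rewrite -coprime_modr -rs coprime_modr coprimeMr => /andP[].
Qed.

Lemma coprime_invmod b r : (1 < b)%N -> coprime r b -> coprime (invmod b r) b.
Proof. by move=> b1 rb; apply: (coprime_of_inv (invmodP b1 rb)). Qed.

Lemma inv_unique b r s t : (r < b)%N -> (t < b)%N ->
  (s * r = 1 %[mod b])%N -> (t * s = 1 %[mod b])%N -> t = r.
Proof.
move=> rb tb sr ts; rewrite -(modn_small rb) -(modn_small tb).
by rewrite -[r]mul1n -modnMml -ts modnMml -mulnA -modnMmr sr modnMmr muln1.
Qed.

Lemma invmodK b r : (1 < b)%N -> (r < b)%N -> coprime r b -> invmod b (invmod b r) = r.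
Proof.
move=> b1 rb cop; have b0 : (0 < b)%N by lia.
exact: (inv_unique rb (invmod_lt _ b0) (invmodP b1 cop) (invmodP b1 (coprime_invmod b1 cop))).
Qed.

(** Inversion modulo b is an involution on the residues coprime to b. *)
Lemma sum_c0_cotsum b k (P : pred nat) : (1 < b)%N ->
  \sum_(0 <= r < b.+1 | P r && coprime r b) c0 r b ^+ (2 * k) =
  \sum_(n < b | P (invmod b n) && coprime n b) (b%:R / pi * cotsum b n) ^+ (2 * k) :> R.
Proof.
move=> b1; have b0 : (0 < b)%N by lia.
rewrite big_mkcond big_nat_recr //= [coprime b b]/coprime gcdnn.
have -> : (b == 1)%N = false by lia.
rewrite andbF addr0 -big_mkcond big_mkord.
pose h (n : 'I_b) := Ordinal (invmod_lt n b0).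
rewrite (reindex_onto h h) /=; last first.
  by move=> r /andP[_ cop]; apply: val_inj => /=; rewrite invmodK.
apply: eq_big => [n|n /andP[/andP[_ cop] /eqP/(congr1 val) /= E]].
  rewrite -andbA; congr (_ && _); apply/andP/idP => [[cop /eqP/(congr1 val) /= E]|cop].
    by rewrite -E; exact: coprime_invmod.
  by rewrite coprime_invmod //; split => //; apply/eqP/val_inj; rewrite /= invmodK.
by rewrite (c0_cotsum R b1 (n := n)) // -{1}E invmodP.
Qed.

Lemma normalized_moment_cotsum (A0 A1 : R) k b : (1 < b)%N ->
  normalized_moment A0 A1 k b = (A1 - A0)^-1 / pi ^+ (2 * k) * (totient b)%:R^-1 *
   \sum_(n < b | (A0 * b%:R <= (invmod b n)%:R <= A1 * b%:R) && coprime n b)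
     cotsum b n ^+ (2 * k).
Proof.
move=> b1; rewrite /normalized_moment.
rewrite (sum_c0_cotsum k (fun r => A0 * b%:R <= r%:R <= A1 * b%:R)) //.
have bk : b%:R ^+ (2 * k) != 0 :> R by rewrite expf_neq0 // pnatr_eq0; lia.
have -> : \sum_(n < b | (A0 * b%:R <= (invmod b n)%:R <= A1 * b%:R) && coprime n b)
     (b%:R / pi * cotsum b n) ^+ (2 * k) = b%:R ^+ (2 * k) / pi ^+ (2 * k) *
   \sum_(n < b | (A0 * b%:R <= (invmod b n)%:R <= A1 * b%:R) && coprime n b)
     cotsum b n ^+ (2 * k).
  by rewrite mulr_sumr; apply: eq_bigr => n _; rewrite exprMn expr_div_n.
rewrite -[RHS](mulKf bk); move: (\sum_(n < b | _) _) => S.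
move: (b%:R ^- (2 * k) : R) (b%:R ^+ (2 * k) : R) (pi ^+ (2 * k) : R)^-1 ((totient b)%:R^-1 : R) (A1 - A0)^-1
  => B1 B Q t d; ring.
Qed.

Lemma even_pow_ge0 (x : R) k : 0 <= x ^+ (2 * k).
Proof. by rewrite exprM exprn_ge0 // sqr_ge0. Qed.

Lemma limit_le_frequently (u : R^nat) (l M : R) : u @ \oo --> l ->
  (forall N, exists2 b, (N <= b)%N & u b <= M) -> l <= M.
Proof.
move=> ul H; rewrite leNgt; apply/negP => Ml.
have [N _ HN] := cvgr_gt _ ul _ Ml; have [b Nb] := H N.
by rewrite leNgt (HN b Nb).
Qed.

Lemma limit_ge_frequently (u : R^nat) (l M : R) : u @ \oo --> l ->
  (forall N, exists2 b, (N <= b)%N & M <= u b) -> M <= l.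
Proof.
move=> ul H; rewrite leNgt; apply/negP => Ml.
have [N _ HN] := cvgr_lt _ ul _ Ml; have [b Nb] := H N.
by rewrite leNgt (HN b Nb).
Qed.

Lemma normalized_moment_ge0 (A0 A1 : R) k b : A0 < A1 -> 0 <= normalized_moment A0 A1 k b.
Proof.
move=> A01; rewrite /normalized_moment !mulr_ge0 ?invr_ge0 ?exprn_ge0 ?subr_ge0 ?(ltW A01) //.
by apply: sumr_ge0 => r _; exact: even_pow_ge0.
Qed.

(** Evaluated along the primes p, for which p / phi(p) <= 2; by positivity the sum
    over r may be extended to all residues n. *)
Lemma limit_moment_le (A0 A1 : R) (H : nat -> R) : A0 < A1 ->
  (forall k, normalized_moment A0 A1 k b @[b --> \oo] --> H k) ->
  forall a : R, 0 < a < 1 -> exists2 C : R, 0 < C &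
    forall k, H k <= C * (2 * k)`!%:R / (a * pi) ^+ (2 * k).
Proof.
move=> A01 HH a a01; have [C C0 HC] := cotsum_moment a01; have /andP[a0 _] := a01.
have dA : 0 < A1 - A0 by rewrite subr_gt0.
have p0 := pi_gt0 R.
exists ((A1 - A0)^-1 * 2 * C); first by rewrite !mulr_gt0 ?invr_gt0.
move=> k; apply: (limit_le_frequently (HH k)) => N.
have [p Np pp] := prime_above N; exists p; first exact: ltnW.
have p1 := prime_gt1 pp; rewrite normalized_moment_cotsum // totient_prime //.
have p1R : 0 < p.-1%:R :> R by rewrite ltr0n; lia.
set S := \sum_(n < p | _) _.
have S0 : 0 <= S by apply: sumr_ge0 => n _; exact: even_pow_ge0.
have SC : S <= C * p%:R * (2 * k)`!%:R / a ^+ (2 * k).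
  apply: le_trans (HC p k); rewrite /S big_mkcond; apply: ler_sum => n _.
  by case: ifP => // _; exact: even_pow_ge0.
have pp2 : p.-1%:R^-1 * p%:R <= 2 :> R.
  by rewrite mulrC ler_pdivrMr // -natrM ler_nat; lia.
have X0 : 0 <= (A1 - A0)^-1 / pi ^+ (2 * k).
  by rewrite divr_ge0 ?invr_ge0 ?exprn_ge0 // ltW.
have Y0 : 0 <= C * (2 * k)`!%:R / a ^+ (2 * k).
  by rewrite divr_ge0 ?mulr_ge0 ?exprn_ge0 ?(ltW C0) ?(ltW a0).
apply: (@le_trans _ _ ((A1 - A0)^-1 / pi ^+ (2 * k) * (2 * (C * (2 * k)`!%:R / a ^+ (2 * k))))).
  rewrite -mulrA ler_wpM2l //.
  apply: (@le_trans _ _ (p.-1%:R^-1 * (C * p%:R * (2 * k)`!%:R / a ^+ (2 * k)))).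
    by rewrite ler_wpM2l ?invr_ge0.
  apply: le_trans (ler_wpM2r Y0 pp2).
  by rewrite le_eqVlt; apply/orP; left; apply/eqP; rewrite !mulrA; congr (_ * _ * _); rewrite mulrAC.
rewrite exprMn invfM le_eqVlt; apply/orP; left; apply/eqP; ring.
Qed.

End moments.

(** * Coprime pairs in a cone *)

Section coprime_pairs.
Variable R : realType.

Lemma count_nat_itv p q N :
  (\sum_(j < N) (p <= j <= q) = minn N q.+1 - p)%N.
Proof.
elim: N => [|N IH]; first by rewrite big_ord0 min0n.
by rewrite big_ord_recr /= IH; lia.
Qed.

Lemma count_itv_le (x y : R) N : 0 <= x <= y ->
  \sum_(j < N) (x <= j%:R <= y)%R%:R <= y - x + 2.
Proof.
move=> /andP[x0 xy]; have y0 : 0 <= y by exact: le_trans xy.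
have := truncn_le x; have := truncnS_gt y; rewrite x0 => yS xS.
set p := Num.truncn x in xS; set q := Num.truncn y in yS.
have pq : (p <= q)%N by apply: le_truncn.
apply: (@le_trans _ _ (q.+1 - p)%:R); last first.
  rewrite natrB; last by lia.
  have := truncn_le y; rewrite y0 -/q => qy; have := truncnS_gt x; rewrite -/p -natr1.
  by rewrite -[q.+1%:R]natr1; lra.
rewrite -natr_sum ler_nat; apply: (@leq_trans (\sum_(j < N) (p <= j <= q))%N).
  apply: leq_sum => j _; case: andP => //= -[xj jy].
  have -> : (p <= j)%N by rewrite -(ler_nat R) (le_trans xS).
  by rewrite /q truncn_ge_nat // jy.
by rewrite count_nat_itv leq_sub2r // geq_minr.
Qed.

Lemma count_itv_ge (x y : R) N : 0 <= x -> y < N%:R ->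
  y - x - 1 <= \sum_(j < N) (x <= j%:R <= y)%R%:R.
Proof.
move=> x0 yN; have [y0|y0] := ltP y 0.
  apply: (@le_trans _ _ 0); [lra|by apply: sumr_ge0].
have xS := truncnS_gt x; have yS := truncnS_gt y.
have xp : (Num.truncn x)%:R <= x by have := truncn_le x; rewrite x0.
have yq : (Num.truncn y)%:R <= y by have := truncn_le y; rewrite y0.
set p := Num.truncn x in xS xp; set q := Num.truncn y in yS yq.
have qN : (q < N)%N by rewrite -(ltr_nat R) (le_lt_trans yq).
apply: (@le_trans _ _ (q.+1 - p.+1)%:R).
  apply: (@le_trans _ _ (q%:R - p%:R)); first by move: yS; rewrite -natr1; lra.
  have [pq|qp] := leqP p q; first by rewrite subSS natrB.
  by apply: (@le_trans _ _ 0) => //; rewrite subr_le0 ler_nat ltnW.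
rewrite -natr_sum ler_nat.
apply: (@leq_trans (\sum_(j < N) (p.+1 <= j <= q))%N).
  by rewrite count_nat_itv; have -> : minn N q.+1 = q.+1 by lia.
apply: leq_sum => j _; case: andP => //= -[pj jq].
have -> : x <= j%:R by apply: ltW; apply: (lt_le_trans xS); rewrite ler_nat.
by have -> : j%:R <= y by apply: le_trans yq; rewrite ler_nat.
Qed.

Lemma sum_multiples (F : nat -> R) d q : (0 < d)%N ->
  \sum_(0 <= i < d * q | (d %| i)%N) F i = \sum_(0 <= i < q) F (d * i)%N.
Proof.
move=> d0; elim: q => [|q IH]; first by rewrite muln0 !big_nil.
rewrite big_nat_recr //= -IH mulnS addnC (big_cat_nat (n := (d * q)%N)) //=; last by lia.
congr (_ + _); rewrite big_ltn_cond; last by lia.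
rewrite dvdn_mulr // big_nat_cond big1 ?addr0 // => i /andP[/andP[i1 i2] /dvdnP[t tE]].
have : (q < t)%N by rewrite -(ltn_pmul2l d0) mulnC; nia.
by nia.
Qed.

Lemma sum_multiples_le (F : nat -> R) d q N : (0 < d)%N -> (N <= d * q)%N ->
  (forall i, 0 <= F i) ->
  \sum_(0 <= i < N | (d %| i)%N) F i <= \sum_(0 <= i < q) F (d * i)%N.
Proof.
move=> d0 Nq F0; rewrite -sum_multiples // [leRHS](big_cat_nat (n := N)) //= lerDl.
by apply: sumr_ge0.
Qed.

(** The bound only has to be below 1; it follows by telescoping, since
    1/d^2 <= 1/(d-1) - 1/d for d >= 3. *)
Lemma sum_inv_sqr_le N : \sum_(2 <= d < N.+1) d%:R ^- 2 <= 3 / 4 :> R.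
Proof.
have [N2|N2] := ltnP N 2.
  by rewrite big_geq //; lra.
suff H m : \sum_(2 <= d < m.+3) d%:R ^- 2 <= 3 / 4 - m.+2%:R^-1 :> R.
  have -> : N.+1 = (N - 2).+3 by lia.
  by apply: (le_trans (H _)); rewrite gerBl invr_ge0.
elim: m => [|m IH]; first by rewrite big_nat1; lra.
rewrite big_nat_recr //=; apply: (le_trans (lerD IH (lexx _))).
have m2 : 0 < m.+2%:R :> R by rewrite ltr0n.
have -> : m.+3%:R = m.+2%:R + 1 :> R by rewrite natr1.
move: m2; move: (m.+2%:R : R) => t t0.
suff : (t + 1) ^- 2 + (t + 1)^-1 <= t^-1 by lra.
have -> : t^-1 = (t * (t + 1))^-1 + (t + 1)^-1.
  by field; apply/andP; split; rewrite gt_eqF // ltr_wpDl // ltW.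
rewrite lerD2r expr2 lef_pV2 ?posrE; [|nra|nra].
nra.
Qed.

Lemma sum_nat_id N : \sum_(0 <= n < N.+1) n%:R = N%:R * (N%:R + 1) / 2 :> R.
Proof.
elim: N => [|N IH]; first by rewrite big_nat1 !mul0r.
by rewrite big_nat_recr //= IH -natr1; field.
Qed.

(** The margin 1 in the upper bound ensures that (j b + 1)/n <= A1 b. *)
Definition fraction_in (A0 A1 : R) n j := (A0 * n%:R <= j%:R) && (j%:R + 1 <= A1 * n%:R).

Definition fraction_count (A0 A1 : R) n : R :=
  \sum_(j < n) (fraction_in A0 A1 n j && coprime j n)%:R.

(** Union bound over the common divisors d >= 2: dividing n and j by d maps the
    pairs with common divisor d into those of a cone of height N/d, so their
    number is about (A1 - A0) N^2 / (2 d^2), and the sum of 1/d^2 is at most 3/4. *)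
Lemma noncoprime_count_le (A0 A1 : R) N : 0 < A0 -> A0 < A1 -> A1 < 1 -> (0 < N)%N ->
  \sum_(0 <= n < N.+1) \sum_(j < n) (fraction_in A0 A1 n j && ~~ coprime j n)%:R
  <= 3 / 8 * (A1 - A0) * N%:R ^+ 2 + 3 * N%:R * (1 + ln N%:R) + 2 * N%:R :> R.
Proof.
move=> A00 A01 A11 N0; set D := A1 - A0; have D0 : 0 < D by rewrite subr_gt0.
have D1 : D < 1 by rewrite /D; lra.
have N0R : 0 < N%:R :> R by rewrite ltr0n.
pose F d n : R := \sum_(0 <= j < n | (d %| j)%N) (fraction_in A0 A1 n j)%:R.
have F0 d n : 0 <= F d n by apply: sumr_ge0.
apply: (@le_trans _ _ (\sum_(0 <= n < N.+1) \sum_(2 <= d < N.+1 | (d %| n)%N) F d n)).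
  rewrite big_nat_cond [leRHS]big_nat_cond; apply: ler_sum => n; rewrite andbT => /andP[_ nN].
  rewrite /F (exchange_big_dep_nat xpredT) //= big_mkord; apply: ler_sum => j _.
  have [/andP[ok nc]|_] := boolP (_ && _); last first.
    by rewrite big_mkcond; apply: sumr_ge0 => d _; case: ifP.
  have n0 : (0 < n)%N by have := ltn_ord j; lia.
  have g0 : (0 < gcdn j n)%N by rewrite gcdn_gt0 n0 orbT.
  have gn : (gcdn j n <= n)%N by rewrite dvdn_leq // dvdn_gcdr.
  have g2 : (2 <= gcdn j n < N.+1)%N by move: nc; rewrite /coprime; lia.
  rewrite big_mkcond /= (bigD1_seq (gcdn j n)) ?mem_index_iota ?iota_uniq //=.
  rewrite dvdn_gcdr dvdn_gcdl ok lerDl; apply: sumr_ge0 => d _; by case: ifP.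
rewrite (exchange_big_dep_nat xpredT) //=.
have Fd d : (2 <= d < N.+1)%N -> \sum_(0 <= n < N.+1 | (d %| n)%N) F d n <=
    D / 2 * (N%:R ^+ 2 * d%:R ^- 2) + 3 * N%:R * d%:R^-1 + 2.
  move=> /andP[d2 dN]; have d0 : (0 < d)%N by lia.
  have d0R : 0 < d%:R :> R by rewrite ltr0n.
  pose q := (N %/ d)%N.
  have Nq : (N.+1 <= d * q.+1)%N by rewrite mulnC ltn_ceil.
  apply: (le_trans (sum_multiples_le d0 Nq (F0 d))).
  apply: (@le_trans _ _ (\sum_(0 <= n < q.+1) (D * n%:R + 2))).
    apply: ler_sum => n _; rewrite /F.
    apply: (le_trans (sum_multiples_le d0 (leqnn _) _)); first by [].
    rewrite big_mkord.
    have -> : D * n%:R + 2 = A1 * n%:R - A0 * n%:R + 2 by rewrite /D; ring.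
    apply: le_trans (count_itv_le n _); last first.
      by rewrite mulr_ge0 ?(ltW A00) //= ler_wpM2r // ltW.
    apply: ler_sum => j _; rewrite ler_nat /fraction_in.
    case: andP => //= -[h1 h2].
    have -> : A0 * n%:R <= j%:R by move: h1; rewrite !natrM mulrCA ler_pM2l.
    have -> // : j%:R <= A1 * n%:R.
    move: h2; rewrite !natrM mulrCA => h2; rewrite -(ler_pM2l d0R).
    by apply: le_trans h2; rewrite lerDl.
  rewrite big_split /= -mulr_sumr sum_nat_id sumr_const_nat subn0.
  have qN : q%:R <= N%:R / d%:R :> R by rewrite ler_pdivlMr // -natrM ler_nat leq_trunc_div.
  have q0 : 0 <= q%:R :> R by [].
  have -> : 2 *+ q.+1 = 2 * (q%:R + 1) :> R by rewrite natr1 mulr_natr.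
  rewrite -exprVn -exprMn -[3 * _ / _]mulrA; move: qN; set t := N%:R / d%:R => qN.
  move: (q%:R : R) q0 qN => s s0 st.
  have st2 : s ^+ 2 <= t ^+ 2 by rewrite ler_sqr ?nnegrE // (le_trans s0).
  have h1 : D / 2 * s ^+ 2 <= D / 2 * t ^+ 2 by rewrite ler_pM2l // divr_gt0.
  have h2 : D / 2 * s <= 1 * s by apply: ler_wpM2r => //; lra.
  have -> : D * (s * (s + 1) / 2) = D / 2 * s ^+ 2 + D / 2 * s by field.
  lra.
rewrite big_nat_cond; apply: (@le_trans _ _ (\sum_(2 <= d < N.+1)
    (D / 2 * (N%:R ^+ 2 * d%:R ^- 2) + 3 * N%:R * d%:R^-1 + 2))).
  rewrite [leRHS]big_nat_cond; apply: ler_sum => d; rewrite andbT => hd; exact: Fd.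
rewrite !big_split /= -!mulr_sumr sumr_const_nat; apply: lerD; first apply: lerD.
- have -> : 3 / 8 * D * N%:R ^+ 2 = D / 2 * (N%:R ^+ 2 * (3 / 4)) by field.
  by rewrite ler_pM2l ?divr_gt0 // ler_pM2l ?exprn_gt0 // sum_inv_sqr_le.
- rewrite ler_pM2l ?mulr_gt0 //; apply: le_trans (harmonic_le R N0).
  by rewrite [leRHS]big_ltn // lerDr invr_ge0.
- by rewrite -mulr2n -[leLHS]mulr_natl ler_pM2l // ler_nat; lia.
Qed.

(** There are about (A1 - A0) N^2 / 2 pairs altogether, of which at most three
    quarters have a common divisor, up to errors O(N log N). *)
Lemma fraction_count_ge (A0 A1 : R) : 0 < A0 -> A0 < A1 -> A1 < 1 ->
  exists N0, forall N, (N0 <= N)%N ->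
    (A1 - A0) / 16 * N%:R ^+ 2 <= \sum_(0 <= n < N.+1) fraction_count A0 A1 n.
Proof.
move=> A00 A01 A11; set D := A1 - A0; have D0 : 0 < D by rewrite subr_gt0.
(* This threshold gives 288 N^(3/2) <= D N^2, which absorbs all error terms. *)
exists (Num.truncn ((288 / D) ^+ 2)).+1 => N NN.
have N0 : (0 < N)%N by lia.
have N1R : 1 <= N%:R :> R by rewrite ler1n.
have h1 : \sum_(0 <= n < N.+1) (D * n%:R - 2) <=
    \sum_(0 <= n < N.+1) \sum_(j < n) (fraction_in A0 A1 n j)%:R.
  apply: ler_sum => n _; case: n => [|n]; first by rewrite big_ord0; lra.
  have n0R : 0 < n.+1%:R :> R by rewrite ltr0n.
  apply: (@le_trans _ _ ((A1 * n.+1%:R - 1) - A0 * n.+1%:R - 1)); first by rewrite /D; lra.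
  apply: le_trans (@count_itv_ge _ _ n.+1 _ _) _; first by rewrite mulr_ge0 // ltW.
    have h : A1 * n.+1%:R <= 1 * n.+1%:R by rewrite ler_wpM2r // ltW.
    by rewrite ltrBlDr; apply: le_lt_trans h _; rewrite mul1r ltrDl.
  apply: ler_sum => j _.
  by have -> : fraction_in A0 A1 n.+1 j = (A0 * n.+1%:R <= j%:R <= A1 * n.+1%:R - 1)
    by rewrite /fraction_in lerBrDr.
have h2 := noncoprime_count_le A00 A01 A11 N0; rewrite -/D in h2.
have h3 : \sum_(0 <= n < N.+1) fraction_count A0 A1 n =
  \sum_(0 <= n < N.+1) \sum_(j < n) (fraction_in A0 A1 n j)%:R -
  \sum_(0 <= n < N.+1) \sum_(j < n) (fraction_in A0 A1 n j && ~~ coprime j n)%:R.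
  rewrite -sumrB; apply: eq_bigr => n _; rewrite -sumrB; apply: eq_bigr => j _.
  by case: fraction_in; case: coprime; rewrite /= ?subr0 ?subrr.
have h4 : \sum_(0 <= n < N.+1) (D * n%:R - 2) = D * (N%:R * (N%:R + 1) / 2) - 2 * (N%:R + 1).
  rewrite sumrB -mulr_sumr sum_nat_id sumr_const_nat subn0; congr (_ - _).
  by rewrite natr1 mulr_natr.
have half : 0 < (2^-1 : R) <= 1 by apply/andP; split; lra.
have h5 := one_add_ln_le half N0; rewrite invrK powR12_sqrt // in h5.
set s := Num.sqrt N%:R in h5; have s2 : N%:R = s ^+ 2 by rewrite sqr_sqrtr.
have s0 : 0 <= s by rewrite sqrtr_ge0.
have s1 : 288 / D <= s.
  rewrite -(@ler_pXn2r _ 2) ?nnegrE ?divr_ge0 ?(ltW D0) // -s2; apply: ltW.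
  by apply: (lt_le_trans (truncnS_gt _)); rewrite ler_nat.
have sD : 288 <= D * s by rewrite mulrC -ler_pdivrMr.
rewrite h3; move: h1 h2; rewrite h4.
move: (\sum_(0 <= n < N.+1) _) (\sum_(0 <= n < N.+1) _) => X Y.
move: (ln N%:R) h5 => l h5; rewrite s2 => h1 h2.
have h6 : 3 * s ^+ 2 * (1 + l) <= 6 * s ^+ 3.
  have -> : 6 * s ^+ 3 = 3 * s ^+ 2 * (s * 2) by ring.
  by rewrite ler_wpM2l // mulr_ge0 // exprn_ge0.
have h7 : 288 * s ^+ 3 <= D * s ^+ 4.
  have -> : D * s ^+ 4 = D * s * s ^+ 3 by ring.
  by rewrite ler_wpM2r // exprn_ge0.
have s11 : 1 <= s by rewrite -(@ler_pXn2r _ 2) ?nnegrE // expr1n -s2.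
have h8 : s ^+ 2 <= s ^+ 3 by rewrite (exprS s 2) ler_peMl // exprn_ge0.
have h9 : 0 <= D * s ^+ 2 by rewrite mulr_ge0 ?exprn_ge0 // ltW.
have h10 : 1 <= s ^+ 2 by rewrite -s2.
rewrite -exprM in h1 h2 *; lra.
Qed.

End coprime_pairs.

(** * Lower bound for the limiting moments *)

Section lower_bound.
Variable R : realType.
Local Notation wt := (@wt R).
Local Notation cotsum := (@cotsum R).
Local Notation cottail := (@cottail R).

(** The residues n that are inverses of the numerators r counted by the moments. *)
Definition good (A0 A1 : R) b n :=
  (A0 * b%:R <= (invmod b n)%:R <= A1 * b%:R) && coprime n b.

(** If n r = j b + 1, then r is the inverse of n modulo b and r/b = j/n + 1/(n b). *)
Lemma fraction_good (A0 A1 : R) b n j : A1 < 1 -> (1 < b)%N -> (0 < n)%N ->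
  fraction_in A0 A1 n j -> (n %| j * b + 1)%N -> good A0 A1 b n.
Proof.
move=> A11 b1 n0 /andP[j0 j1] /dvdnP[r rE].
have n0R : 0 < n%:R :> R by rewrite ltr0n.
have b0R : 1 <= b%:R :> R by rewrite ler1n; lia.
have rER : r%:R * n%:R = j%:R * b%:R + 1 :> R by rewrite -!natrM -rE natrD.
have nr : (n * r = 1 %[mod b])%N by rewrite mulnC -rE modnMDl.
have cop := coprime_of_inv nr.
have r1 : r%:R <= A1 * b%:R.
  rewrite -(ler_pM2r n0R) rER mulrAC; apply: (@le_trans _ _ ((j%:R + 1) * b%:R)).
    by rewrite mulrDl mul1r lerD2l.
  by rewrite ler_wpM2r // (le_trans _ b0R).
have rb : (r < b)%N.
  rewrite -(ltr_nat R) (le_lt_trans r1) // -[ltRHS]mul1r ltr_pM2r //.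
  by rewrite (lt_le_trans _ b0R).
have -> : good A0 A1 b n = (A0 * b%:R <= r%:R <= A1 * b%:R).
  rewrite /good cop andbT (inv_unique rb (invmod_lt _ _) nr (invmodP b1 cop)) //; lia.
rewrite r1 andbT -(ler_pM2r n0R) rER mulrAC; apply: (@le_trans _ _ (j%:R * b%:R)).
  by rewrite ler_wpM2r // (le_trans _ b0R).
by rewrite lerDl.
Qed.

Lemma sum_blocks_ge (f : nat -> R) n x M : (forall y, 1 <= \sum_(y <= b < y + n) f b) ->
  M%:R <= \sum_(x <= b < x + M * n) f b.
Proof.
move=> H; elim: M => [|M IH]; first by rewrite mul0n addn0 big_geq.
rewrite mulSn [(n + _)%N]addnC addnA (big_cat_nat (n := (x + M * n)%N)) ?leq_addr //=.
by rewrite -natr1 lerD.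
Qed.

Lemma block_solution n j y : (0 < n)%N -> coprime j n ->
  exists2 b, (y <= b < y + n)%N & (n %| j * b + 1)%N.
Proof.
move=> n0 cop; have [a an] := Bezoutr j n0; rewrite (eqP cop) => na.
pose z := ((a + (n - y %% n)) %% n)%N.
exists (y + z)%N; first by rewrite leq_addr ltn_add2l ltn_mod.
have E : (y + z = a %[mod n])%N.
  have yn := ltn_pmod y n0; rewrite /z modnDmr -modnDml.
  have -> : (y %% n + (a + (n - y %% n)) = a + n)%N by lia.
  exact: modnDr.
by rewrite addnC /dvdn -modnDmr -modnMmr E modnMmr modnDmr [(j * a)%N]mulnC; exact: na.
Qed.

(** For fixed b and n at most one j below n satisfies n | j b + 1, because that
    divisibility makes b invertible modulo n. *)
Lemma fraction_count_le_good (A0 A1 : R) b n : A1 < 1 -> (1 < b)%N -> (0 < n)%N ->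
  \sum_(j < n) ((fraction_in A0 A1 n j && coprime j n) && (n %| j * b + 1)%N)%:R
  <= (good A0 A1 b n)%:R :> R.
Proof.
move=> A11 b1 n0.
pose P (j : 'I_n) := (fraction_in A0 A1 n j && coprime j n) && (n %| j * b + 1)%N.
change (\sum_(j < n) (P j)%:R <= (good A0 A1 b n)%:R :> R).
have [[j Pj]|nP] := pselect (exists j, P j); last first.
  by rewrite big1 // => j _; case: (boolP (P j)) => // Pj; case: nP; exists j.
rewrite (bigD1 j) //= big1 ?addr0 => [|i ij]; last first.
  case: (boolP (P i)) => // Pi; case/eqP: ij; apply: val_inj => /=.
  move: Pi Pj => /andP[_ ni] /andP[_ nj].
  have cop : coprime n b.
    rewrite /coprime -dvdn1 -(dvdn_addr (m := (j * b)%N)) ?dvdn_mull ?dvdn_gcdr //.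
    exact: dvdn_trans (dvdn_gcdl _ _) nj.
  wlog ij : i j ni nj / (i <= j)%N.
    by move=> H; have [/H->//|/ltnW/H->] := leqP i j.
  have : (n %| (j - i) * b)%N.
    have -> : ((j - i) * b = (j * b + 1) - (i * b + 1))%N by rewrite mulnBl; lia.
    by rewrite dvdn_sub.
  rewrite Gauss_dvdl // => /dvdnP[[|q] qE]; first by lia.
  have := ltn_ord j; nia.
rewrite Pj; move: Pj => /andP[/andP[fj _] nj].
by rewrite (fraction_good A11 b1 n0 fj nj).
Qed.

(** For each admissible j, every block of n consecutive moduli b contains a
    solution of n | j b + 1, and [M N, 2 M N) contains M such blocks as n <= N.
    Averaging over b thus replaces estimates for the distribution of inverses
    modulo a single b. *)
Lemma good_count_ge (A0 A1 : R) M N n : A1 < 1 -> (0 < M)%N -> (1 < N)%N ->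
  (0 < n <= N)%N ->
  M%:R * fraction_count A0 A1 n <= \sum_(M * N <= b < (M * N).*2) (good A0 A1 b n)%:R.
Proof.
move=> A11 M0 N1 /andP[n0 nN].
apply: (@le_trans _ _ (\sum_(M * N <= b < M * N + M * n) (good A0 A1 b n)%:R)); last first.
  rewrite [leRHS](big_cat_nat (n := (M * N + M * n)%N)) ?leq_addr //=; first by rewrite lerDl; apply: sumr_ge0.
  by rewrite -addnn leq_add2l leq_mul2l nN orbT.
apply: (@le_trans _ _ (\sum_(M * N <= b < M * N + M * n)
  \sum_(j < n) ((fraction_in A0 A1 n j && coprime j n) && (n %| j * b + 1)%N)%:R)); last first.
  rewrite big_nat_cond [leRHS]big_nat_cond; apply: ler_sum => b; rewrite andbT => hb.
  by apply: fraction_count_le_good => //; nia.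
rewrite exchange_big /= /fraction_count mulr_sumr; apply: ler_sum => j _.
case: (boolP (_ && _)) => [/andP[fj cop]|_]; last by rewrite mulr0; apply: sumr_ge0.
rewrite mulr1; apply: sum_blocks_ge => y.
have [b yb nb] := block_solution y n0 cop.
rewrite (bigD1_seq b) ?mem_index_iota ?iota_uniq //= nb lerDl.
by apply: sumr_ge0.
Qed.

Lemma saw_ge b a : (0 < b)%N -> (0 < a)%N -> 1 - 2 * (a%:R / b%:R) <= saw R b a.
Proof.
move=> b0 a0; have b0R : 0 < b%:R :> R by rewrite ltr0n.
rewrite /saw; case: ifPn => [/(dvdn_leq a0) ba|_].
  have : 1 <= a%:R / b%:R :> R by rewrite ler_pdivlMr // mul1r ler_nat.
  by move: (a%:R / b%:R : R) => t; lra.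
rewrite lerD2l lerN2 -[leLHS]mulrA ler_pM2l // ler_pM2r ?invr_gt0 // ler_nat.
exact: leq_mod.
Qed.

Lemma cothead_nat b L n :
  \sum_(m < b | (m <= L)%N) wt b m * saw R b (m * n) =
  \sum_(1 <= m < L.+1) wt b m * saw R b (m * n).
Proof.
pose F m := wt b m * saw R b (m * n).
have Fb m : ~~ (m < b)%N -> F m = 0 by move=> mb; rewrite /F wt_out ?mul0r //; lia.
have -> : \sum_(1 <= m < L.+1) F m = \sum_(0 <= m < L.+1) F m.
  by rewrite [RHS]big_ltn // {2}/F wt_out // mul0r add0r.
rewrite -(big_mkord (fun m => (m <= L)%N) F).
rewrite (big_nat_widen _ _ (maxn b L.+1)) ?leq_maxl //.
rewrite [RHS](big_nat_widen _ _ (maxn b L.+1)) ?leq_maxr //.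
rewrite big_mkcond [RHS]big_mkcond; apply: eq_bigr => m _ /=; rewrite ltnS.
by case: (m <= L)%N => //=; case: ifPn => // /Fb.
Qed.

(** The sawtooth is at least 1 - 2 m n / b, and n / b <= 1/M, so the terms with
    m <= M add up to at least log M - 4; the terms with M < m <= L are at least
    -1/m and cost at most log L - log M + 1. *)
Lemma cotsum_ge b n M N L : (0 < n <= N)%N -> (0 < M <= L)%N -> (2 < N)%N -> (M * N <= b)%N ->
  2 * ln M%:R - ln L%:R - 6 - `|cottail b L n| <= cotsum b n - 1.
Proof.
move=> /andP[n0 nN] /andP[M0 ML] N2 MNb.
have Mb : (M * 3 <= b)%N by rewrite (leq_trans _ MNb) // leq_mul2l N2 orbT.
have nMb : (n * M <= b)%N by rewrite (leq_trans _ MNb) // mulnC leq_mul2l nN orbT.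
have b0 : (0 < b)%N by lia.
have mb m : (m <= M)%N -> (m.*2 < b)%N by lia.
have Mb4 : (4 * M <= 2 * b)%N by lia.
have b0R : 0 < b%:R :> R by rewrite ltr0n.
have M0R : 0 < M%:R :> R by rewrite ltr0n.
rewrite (cotsum_split R b L n) cothead_nat.
have hT : - `|cottail b L n| <= cottail b L n by rewrite lerNl -normrN ler_norm.
suff hH : 2 * ln M%:R - ln L%:R - 5 <= \sum_(1 <= m < L.+1) wt b m * saw R b (m * n) by lra.
rewrite (big_cat_nat (n := M.+1)) //=.
have hM := harmonic_ge R M0; have hL := harmonic_le R (leq_trans M0 ML).
rewrite (big_cat_nat (n := M.+1)) //= in hL.
have h1 : - \sum_(M.+1 <= m < L.+1) m%:R^-1 <= \sum_(M.+1 <= m < L.+1) wt b m * saw R b (m * n).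
  rewrite -sumrN; apply: ler_sum => m _; rewrite lerNl -mulrN.
  rewrite (le_trans (ler_norm _)) // normrM normrN (ger0_norm (wt_ge0 _ _ _)).
  by rewrite -[leRHS]mulr1 ler_pM ?wt_ge0 ?wt_le ?norm_saw_le1.
have h2 : \sum_(1 <= m < M.+1) m%:R^-1 - 4 <= \sum_(1 <= m < M.+1) wt b m * saw R b (m * n).
  have -> : \sum_(1 <= m < M.+1) m%:R^-1 - 4 = \sum_(1 <= m < M.+1) (m%:R^-1 - 4 / M%:R) :> R.
    rewrite sumrB sumr_const_nat subSS subn0 -[_ *+ M]mulr_natr divfK //.
    by rewrite gt_eqF.
  rewrite big_nat_cond [leRHS]big_nat_cond; apply: ler_sum => m; rewrite andbT ltnS => /andP[m0 mM].
  have m0R : 0 < m%:R :> R by rewrite ltr0n.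
  have /andP[w1 w2] := wt_bounds R m0 (mb m mM).
  have w0 := wt_ge0 R b m.
  have mn0 : (0 < m * n)%N by rewrite muln_gt0 m0.
  have s := saw_ge b0 mn0.
  have nb : n%:R / b%:R <= M%:R^-1 :> R.
    by rewrite ler_pdivrMr // mulrC ler_pdivlMr // -natrM ler_nat.
  have pib : pi / b%:R <= 2 / M%:R :> R.
    rewrite ler_pdivrMr // mulrAC ler_pdivlMr //.
    have p4 : (pi : R) <= 4 by have := pihalf_lt2 R; lra.
    apply: (@le_trans _ _ (4 * M%:R)); first by rewrite ler_pM2r.
    by rewrite -!natrM ler_nat.
  apply: le_trans (ler_wpM2l w0 s); rewrite mulrBr mulr1.
  have h : wt b m * (2 * ((m * n)%:R / b%:R)) <= 2 / M%:R.
    have -> : wt b m * (2 * ((m * n)%:R / b%:R)) = (wt b m * m%:R) * (2 * (n%:R / b%:R)).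
      by rewrite natrM; ring.
    apply: (@le_trans _ _ (1 * (2 * M%:R^-1))); last by rewrite mul1r.
    apply: ler_pM; rewrite ?mulr_ge0 ?divr_ge0 //; last by rewrite ler_pM2l.
    by rewrite -ler_pdivlMr // mul1r.
  have -> : 4 / M%:R = 2 / M%:R + 2 / M%:R :> R by field; rewrite gt_eqF.
  lra.
lra.
Qed.

(** Converts the mean square bound for the tail T into a lower bound for a moment
    of S without discarding exceptional terms: where T > 1 the left side is
    not positive, elsewhere S >= a. *)
Lemma even_pow_ge_truncated (a S T : R) k : 0 <= a -> a - T <= S - 1 -> 0 <= T ->
  a ^+ (2 * k) * (1 - T ^+ 2) <= S ^+ (2 * k).
Proof.
move=> a0 aS T0; have ak : 0 <= a ^+ (2 * k) by exact: even_pow_ge0.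
have [T1|T1] := leP T 1; last first.
  apply: (@le_trans _ _ 0); last exact: even_pow_ge0.
  by rewrite mulr_ge0_le0 // subr_le0 expr_ge1 // ltW.
apply: (@le_trans _ _ (a ^+ (2 * k))); first by rewrite ler_piMr // gerBl sqr_ge0.
have aS1 : a <= S by lra.
by apply: lerXn2r => //; rewrite nnegrE // (le_trans a0).
Qed.

Lemma pigeonhole (U : nat -> R) (W : R) x y : (x < y)%N ->
  (y - x)%:R * W <= \sum_(x <= b < y) U b -> exists2 b, (x <= b < y)%N & W <= U b.
Proof.
move=> xy h; apply: contrapT => nex; move: h; apply/negP; rewrite -ltNge.
rewrite mulr_natl -sumr_const_nat; apply: ltr_sum_nat => // b xby.
by rewrite ltNge; apply/negP => WU; apply: nex; exists b.
Qed.

Lemma totient_le b : (totient b <= b)%N.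
Proof.
rewrite totient_count_coprime -[leqRHS]subn0 -[leqRHS]muln1 -sum_nat_const_nat.
by apply: leq_sum => d _; case: coprime.
Qed.

Lemma sum_initial_le (F : nat -> R) N b : (N < b)%N -> (forall n, 0 <= F n) ->
  \sum_(1 <= n < N.+1) F n <= \sum_(n < b) F n.
Proof.
move=> Nb F0; rewrite -(big_mkord xpredT F) [leRHS](big_cat_nat (n := N.+1)) //=.
rewrite [X in _ <= X + _]big_ltn // addrAC lerDr addr_ge0 //.
by apply: sumr_ge0.
Qed.

Lemma normalized_moment_ge (A0 A1 : R) k b N B : A0 < A1 -> (1 < b)%N -> (N < b)%N ->
  (b <= B)%N ->
  (A1 - A0)^-1 / pi ^+ (2 * k) * (B%:R^-1 *
    \sum_(1 <= n < N.+1) (good A0 A1 b n)%:R * cotsum b n ^+ (2 * k))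
  <= normalized_moment A0 A1 k b.
Proof.
move=> A01 b1 Nb bB; rewrite normalized_moment_cotsum // -[leRHS]mulrA.
have D0 : 0 < A1 - A0 by rewrite subr_gt0.
have t0 : 0 < (totient b)%:R :> R by rewrite ltr0n totient_gt0; lia.
have F0 n : 0 <= (good A0 A1 b n)%:R * cotsum b n ^+ (2 * k).
  by rewrite mulr_ge0 // even_pow_ge0.
rewrite ler_wpM2l ?divr_ge0 ?invr_ge0 ?exprn_ge0 ?pi_ge0 ?(ltW D0) //.
apply: ler_pM; rewrite ?invr_ge0 //; first by apply: sumr_ge0.
  have B0 : 0 < B%:R :> R by rewrite ltr0n; lia.
  rewrite lef_pV2 ?posrE //.
  by rewrite ler_nat (leq_trans (totient_le b)).
apply: (le_trans (sum_initial_le Nb F0)); rewrite [leRHS]big_mkcond /=.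
apply: ler_sum => n _; rewrite -/(good A0 A1 b n).
by case: good; rewrite ?mul1r ?mul0r.
Qed.

Lemma good_total_ge (A0 A1 : R) N0 M N : A1 < 1 -> (0 < M)%N -> (1 < N)%N -> (N0 <= N)%N ->
  (forall N, (N0 <= N)%N ->
    (A1 - A0) / 16 * N%:R ^+ 2 <= \sum_(0 <= n < N.+1) fraction_count A0 A1 n) ->
  (A1 - A0) / 16 / M%:R * (M * N)%:R ^+ 2 <=
  \sum_(M * N <= b < (M * N).*2) \sum_(1 <= n < N.+1) (good A0 A1 b n)%:R.
Proof.
move=> A11 M0 N1 N0N HN0; have M0R : 0 < M%:R :> R by rewrite ltr0n.
apply: (@le_trans _ _ (M%:R * \sum_(0 <= n < N.+1) fraction_count A0 A1 n)).
  have -> : (A1 - A0) / 16 / M%:R * (M * N)%:R ^+ 2 = M%:R * ((A1 - A0) / 16 * N%:R ^+ 2).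
    by rewrite natrM; field; rewrite gt_eqF.
  by rewrite ler_pM2l // HN0.
rewrite big_ltn // {1}/fraction_count big_ord0 add0r mulr_sumr exchange_big /=.
rewrite big_nat_cond [leRHS]big_nat_cond; apply: ler_sum => n; rewrite andbT ltnS => hn.
exact: good_count_ge.
Qed.

(** The hypothesis on L makes the total mean square of the tails at most half of
    the number of good pairs (b, n). *)
Lemma cotsum_good_total_ge (A0 A1 : R) (e C a : R) k M N L :
  (1 < M <= L)%N -> (2 < N)%N ->
  (forall b, \sum_(n < b) cottail b L n ^+ 2 <= C * b%:R * L%:R `^ (e - 1)) -> 0 < C ->
  4 * C * L%:R `^ (e - 1) <= (A1 - A0) / 16 / M%:R ->
  (A1 - A0) / 16 / M%:R * (M * N)%:R ^+ 2 <=
  \sum_(M * N <= b < (M * N).*2) \sum_(1 <= n < N.+1) (good A0 A1 b n)%:R ->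
  0 <= a -> a <= 2 * ln M%:R - ln L%:R - 6 ->
  (M * N)%:R * ((A1 - A0) / 16 / M%:R * (M * N)%:R / 2 * a ^+ (2 * k)) <=
  \sum_(M * N <= b < (M * N).*2)
    \sum_(1 <= n < N.+1) (good A0 A1 b n)%:R * cotsum b n ^+ (2 * k).
Proof.
move=> /andP[M1 ML] N2 HC C0; set g := (A1 - A0) / 16 / M%:R; set B := (M * N)%N => HL HG a0 ha.
have ak : 0 <= a ^+ (2 * k) by exact: even_pow_ge0.
have B0 : (0 < B)%N by rewrite /B muln_gt0; lia.
have ML' : (0 < M <= L)%N by rewrite ML andbT ltnW.
have B0R : 0 < B%:R :> R by rewrite ltr0n.
have NB b : (B <= b)%N -> (N < b)%N by rewrite /B => Bb; nia.
apply: (@le_trans _ _ (\sum_(B <= b < B.*2) \sum_(1 <= n < N.+1)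
   a ^+ (2 * k) * ((good A0 A1 b n)%:R - cottail b L n ^+ 2))); last first.
  rewrite big_nat_cond [leRHS]big_nat_cond; apply: ler_sum => b; rewrite andbT => /andP[Bb _].
  rewrite big_nat_cond [leRHS]big_nat_cond; apply: ler_sum => n; rewrite andbT ltnS => hn.
  case: good => /=; last by rewrite mul0r sub0r mulrN oppr_le0 mulr_ge0 // sqr_ge0.
  rewrite mul1r -real_normK ?num_real //; apply: even_pow_ge_truncated => //.
  by apply: le_trans (cotsum_ge hn ML' N2 Bb); rewrite lerD2r.
under eq_bigr do rewrite -mulr_sumr sumrB.
rewrite -mulr_sumr sumrB.
have -> : B%:R * (g * B%:R / 2 * a ^+ (2 * k)) = a ^+ (2 * k) * (g * B%:R ^+ 2 / 2) by ring.
rewrite ler_wpM2l //.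
have hT : \sum_(B <= b < B.*2) \sum_(1 <= n < N.+1) cottail b L n ^+ 2 <= g * B%:R ^+ 2 / 2.
  apply: (@le_trans _ _ (\sum_(B <= b < B.*2) g * B%:R / 2)); last first.
    rewrite sumr_const_nat -addnn addnK -[leLHS]mulr_natr.
    by rewrite le_eqVlt; apply/orP; left; apply/eqP; ring.
  rewrite big_nat_cond [leRHS]big_nat_cond; apply: ler_sum => b; rewrite andbT => /andP[Bb bB].
  apply: (le_trans (sum_initial_le (NB _ Bb) (fun n => sqr_ge0 (cottail b L n)))).
  apply: (le_trans (HC b)).
  have b2 : b%:R <= 2 * B%:R :> R by rewrite -natrM ler_nat; lia.
  apply: (@le_trans _ _ (C * (2 * B%:R) * L%:R `^ (e - 1))).
    by rewrite ler_wpM2r ?powR_ge0 // ler_pM2l.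
  have -> : C * (2 * B%:R) * L%:R `^ (e - 1) = (4 * C * L%:R `^ (e - 1)) * B%:R / 2 by field.
  by rewrite ler_pM2r ?invr_gt0 // ler_pM2r.
move: HG; lra.
Qed.

(** With e = h/(1+h), the cut-off L = (Q M)^(1+h) satisfies L^(e-1) = 1/(Q M),
    which is what the count of good pairs requires for Q large, while
    log L <= (1+h) log M + O(1) leaves (1-h) log M - O(1) for the head.  Among
    the b in [M N, 2 M N) one has at least the average, and N is arbitrarily
    large. *)
Lemma limit_moment_ge (A0 A1 : R) (H : nat -> R) : 0 < A0 -> A0 < A1 -> A1 < 1 ->
  (forall k, normalized_moment A0 A1 k b @[b --> \oo] --> H k) ->
  forall h : R, 0 < h < 1 -> exists2 c : R, 0 < c & exists K : R, forall M k, (1 < M)%N ->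
    0 <= (1 - h) * ln M%:R - K ->
    c * ((1 - h) * ln M%:R - K) ^+ (2 * k) / (M%:R * pi ^+ (2 * k)) <= H k.
Proof.
move=> A00 A01 A11 HH h /andP[h0 h1]; set D := A1 - A0.
have D0 : 0 < D by rewrite subr_gt0.
have [N0 HN0] := fraction_count_ge A00 A01 A11; rewrite -/D in HN0.
pose e := h / (1 + h).
have h10 : 0 < 1 + h by lra.
have e01 : 0 < e < 1 by rewrite /e divr_gt0 //= ltr_pdivrMr // mul1r; lra.
have [C C0 HC] := cottail_mean_square e01.
pose Q := 1 + 64 * C / D.
have Q1 : 1 <= Q by rewrite /Q lerDl divr_ge0 ?mulr_ge0 ?ltW.
have Q0 : 0 < Q by rewrite (lt_le_trans ltr01).
exists (D^-1 * (D / 16) / 4).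
  by rewrite divr_gt0 ?mulr_gt0 ?invr_gt0 ?divr_gt0.
exists (6 + ln 2 + (1 + h) * ln Q) => M k M1.
have M0 : (0 < M)%N := ltnW M1.
have M0R : 0 < M%:R :> R by rewrite ltr0n.
have M1R : 1 <= M%:R :> R by rewrite ler1n.
have QM1 : 1 <= Q * M%:R by rewrite -[leLHS]mulr1 ler_pM.
have QM0 : 0 < Q * M%:R by rewrite mulr_gt0.
pose X := (Q * M%:R) `^ (1 + h).
have X1 : Q * M%:R <= X by rewrite /X le1r_powR // lerDl ltW.
have X11 : 1 <= X by exact: le_trans X1.
pose L := (Num.truncn X).+1.
have XL : X <= L%:R by rewrite ltW // truncnS_gt.
have L0R : 0 < L%:R :> R by rewrite ltr0n.
have L2X : L%:R <= 2 * X.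
  have := truncn_le X; rewrite (le_trans ler01 X11) /L -natr1; lra.
have ML : (1 < M <= L)%N.
  rewrite M1 -(ler_nat R) (le_trans _ XL) // (le_trans _ X1) //.
  by rewrite -[leLHS]mul1r ler_pM2r.
have lnL : ln L%:R <= ln 2 + (1 + h) * (ln Q + ln M%:R).
  apply: (@le_trans _ _ (ln (2 * X))).
    by rewrite ler_ln ?posrE // mulr_gt0 // (lt_le_trans ltr01).
  rewrite lnM ?posrE //; last by rewrite (lt_le_trans ltr01).
  by rewrite /X ln_powR lnM ?posrE.
have HL : 4 * C * L%:R `^ (e - 1) <= D / 16 / M%:R.
  apply: (@le_trans _ _ (4 * C * (Q * M%:R)^-1)).
    rewrite ler_pM2l ?mulr_gt0 //.
    apply: (@le_trans _ _ (X `^ (e - 1))).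
      rewrite -(opprB 1 e) !powRN lef_pV2 ?posrE ?powR_gt0 ?(lt_le_trans ltr01 X11) //.
      rewrite ge0_ler_powR ?nnegrE ?(ltW L0R) ?(le_trans ler01 X11) //.
      by case/andP: e01 => _ /ltW; rewrite subr_ge0.
    rewrite /X -powRrM (_ : (1 + h) * (e - 1) = -1); last by rewrite /e; field; rewrite gt_eqF.
    by rewrite powR_inv1 // ltW.
  rewrite invfM mulrA ler_pM2r ?invr_gt0 // ler_pdivrMr //.
  have -> : D / 16 * Q = D / 16 + 4 * C by rewrite /Q; field; rewrite gt_eqF.
  by rewrite lerDr divr_ge0 // ltW.
set a := (1 - h) * ln M%:R - _ => a0.
have ha : a <= 2 * ln M%:R - ln L%:R - 6.
  by rewrite /a; move: lnL; rewrite mulrDr; lra.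
apply: (limit_ge_frequently (HH k)) => N'.
pose N := maxn (maxn N0 N') 3.
have N2 : (2 < N)%N by rewrite /N leq_max orbT.
have N0N : (N0 <= N)%N by rewrite /N !leq_max leqnn.
have N'N : (N' <= N)%N by rewrite /N !leq_max leqnn orbT.
have HG := good_total_ge A11 (ltnW M1) (ltnW N2) N0N HN0.
have HCL b : \sum_(n < b) cottail b L n ^+ 2 <= C * b%:R * L%:R `^ (e - 1) by exact: HC.
have := cotsum_good_total_ge k ML N2 HCL C0 HL HG a0 ha.
set B := (M * N)%N => HT.
have N_gt0 : (0 < N)%N := ltn_trans (isT : 0 < 2)%N N2.
have B0 : (0 < B)%N by rewrite /B muln_gt0 M0.
have BB : (B < B.*2)%N by rewrite -addnn -[X in (X < _)%N]addn0 ltn_add2l.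
have BE : B = (B.*2 - B)%N by rewrite -addnn addnK.
rewrite {1}BE in HT; have [b /andP[Bb bB] hb] := pigeonhole BB HT.
have NB : (N < B)%N by rewrite /B -[X in (X < _)%N]mul1n ltn_mul2r N_gt0.
have Nb : (N < b)%N := leq_trans NB Bb.
exists b; first exact: leq_trans N'N (ltnW Nb).
have b1 : (1 < b)%N := leq_ltn_trans N_gt0 Nb.
apply: le_trans (normalized_moment_ge k A01 b1 Nb (ltnW bB)).
have D2 : 0 <= D^-1 / pi ^+ (2 * k) by rewrite divr_ge0 ?invr_ge0 ?exprn_ge0 ?pi_ge0 ?(ltW D0).
apply: le_trans (ler_wpM2l D2 (ler_wpM2l _ hb)); last by rewrite invr_ge0.
have B0R : 0 < B%:R :> R by rewrite ltr0n.
have p0 : pi ^+ (2 * k) != 0 :> R by rewrite expf_neq0 // gt_eqF // pi_gt0.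
rewrite le_eqVlt; apply/orP; left; apply/eqP.
rewrite -muln2 natrM; move: p0; move: (pi ^+ (2 * k) : R) (a ^+ (2 * k)) => P A P0.
rewrite -/D; suff E : forall x y z : R, 0 < x -> 0 < y -> 0 < z ->
    z^-1 * (z / 16) / 4 * A / (y * P) = z^-1 / P * ((x * 2)^-1 * (z / 16 / y * x / 2 * A)) by exact: E.
move=> x y z /lt0r_neq0 x0 /lt0r_neq0 y0 /lt0r_neq0 z0.
by field; rewrite ?x0 ?y0 ?z0 ?P0.
Qed.

End lower_bound.

(** * The radius of convergence *)

Section radius.
Variable R : realType.

(** The odd term of order 2k + 1 is at most s times the even term of order 2k. *)
Lemma expR_le_even_terms (s A q : R) : 0 <= s -> 0 <= q < 1 ->
  (forall k, s ^+ (2 * k) / (2 * k)`!%:R <= A * q ^+ k) ->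
  expR s <= A * (1 + s) / (1 - q).
Proof.
move=> s0 q01 H; have /andP[q0 q1] := q01.
have A0 : 0 <= A by have := H 0%N; rewrite muln0 fact0 !expr0 divr1 mulr1; apply: le_trans.
have even_sum n : \sum_(0 <= i < n.*2) s ^+ i / i`!%:R <= A * (1 + s) * \sum_(k < n) q ^+ k.
  elim: n => [|n IH]; first by rewrite big_nil big_ord0 mulr0.
  rewrite doubleS !big_nat_recr //= big_ord_recr /= mulrDr -addrA; apply: lerD => //.
  rewrite -mul2n [A * _]mulrC -mulrA mulrDl mul1r; apply: lerD; first exact: H.
  rewrite exprS factS natrM invfM -mulrA [_^-1 * _]mulrC mulrA -mulrA mulrCA.
  have h : s / (2 * n).+1%:R <= s.
    by rewrite -[leRHS]mulr1 ler_wpM2l // invf_le1 ?ltr0n // ler1n.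
  apply: (@le_trans _ _ (s * (s ^+ (2 * n) / (2 * n)`!%:R))); last by rewrite ler_wpM2l.
  have -> : s ^+ (2 * n) * (s * ((2 * n)`!%:R^-1 / (2 * n).+1%:R)) =
    (s / (2 * n).+1%:R) * (s ^+ (2 * n) / (2 * n)`!%:R) by rewrite mulrCA mulrACA mulrA; ring.
  by rewrite ler_wpM2r // divr_ge0 // exprn_ge0.
apply: limr_le; first exact: is_cvg_series_exp_coeff.
exists 0%N => // n _; rewrite /series /=.
apply: (@le_trans _ _ (\sum_(0 <= i < n.*2) s ^+ i / i`!%:R)).
  rewrite [leRHS](big_cat_nat (n := n)) //= -?addnn ?leq_addr // lerDl.
  by apply: sumr_ge0 => i _; rewrite divr_ge0 // exprn_ge0.
apply: (le_trans (even_sum n)); rewrite ler_wpM2l ?geometric_sum_le //.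
by rewrite mulr_ge0 // addr_ge0.
Qed.

Lemma expR_gt_affine (c d : R) : exists2 v0, 0 <= v0 & forall v, v0 <= v -> c + d * v < expR v.
Proof.
exists (1 + 2 * (`|c| + `|d|)) => [|v hv]; first by rewrite addr_ge0 ?mulr_ge0 ?addr_ge0.
have c0 := normr_ge0 c; have d0 := normr_ge0 d.
have v1 : 1 <= v by apply: le_trans hv; rewrite lerDl mulr_ge0 ?addr_ge0.
have v0 : 0 <= v by exact: le_trans v1.
have h : 1 + v ^+ 2 / 2 <= expR v by exact: (expR_ge1Dxn 1 v0).
have h1 : c <= `|c| * v by rewrite (le_trans (ler_norm c)) // ler_peMr.
have h2 : d * v <= `|d| * v by rewrite ler_wpM2r // ler_norm.
have h3 : 2 * (`|c| + `|d|) * v <= v * v by rewrite ler_wpM2r //; lra.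
apply: lt_le_trans h; rewrite expr2; lra.
Qed.

(** Comparison with a geometric series of ratio |x| / (a pi)^2, where a lies
    between sqrt |x| / pi and 1. *)
Lemma moment_series_cvg (H : nat -> R) (x : R) : (forall k, 0 <= H k) ->
  (forall a : R, 0 < a < 1 -> exists2 C : R, 0 < C &
    forall k, H k <= C * (2 * k)`!%:R / (a * pi) ^+ (2 * k)) ->
  `|x| < pi ^+ 2 -> cvgn (pseries (fun k => H k / (2 * k)`!%:R) x).
Proof.
move=> H0 HC xpi; have p0 := pi_gt0 R.
pose r := Num.sqrt `|x| / pi.
have r0 : 0 <= r by rewrite divr_ge0 ?sqrtr_ge0 ?ltW.
have r1 : r < 1.
  rewrite ltr_pdivrMr // mul1r -(@ltr_pXn2r _ 2) ?nnegrE ?sqrtr_ge0 ?(ltW p0) //.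
  by rewrite sqr_sqrtr.
pose a := (1 + r) / 2.
have a01 : 0 < a < 1 by rewrite /a; apply/andP; split; lra.
have /andP[a0 a1] := a01.
have [C C0 HCk] := HC a a01.
have ap0 : 0 < a * pi by rewrite mulr_gt0.
pose q := `|x| / (a * pi) ^+ 2.
have q0 : 0 <= q by rewrite divr_ge0 // exprn_ge0 // ltW.
have q1 : q < 1.
  rewrite ltr_pdivrMr ?exprn_gt0 // mul1r -(sqr_sqrtr (normr_ge0 x)).
  rewrite ltr_pXn2r ?nnegrE ?sqrtr_ge0 ?(ltW ap0) //.
  by rewrite -ltr_pdivrMr // -/r /a; lra.
apply: normed_cvg; apply: (@series_le_cvg _ _ (geometric C q)) => [k|k|k|].
- exact: normr_ge0.
- by rewrite /geometric /= mulr_ge0 ?exprn_ge0 // ltW.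
- have f0 : 0 < (2 * k)`!%:R :> R by rewrite ltr0n fact_gt0.
  rewrite /geometric /= normrM normrX ger0_norm ?divr_ge0 //.
  rewrite /q expr_div_n -exprM mulrA [leRHS]mulrAC ler_wpM2r ?exprn_ge0 //.
  rewrite ler_pdivrMr // mulrAC; exact: HCk.
- by apply: is_cvg_geometric_series; rewrite ger0_norm.
Qed.

(** Let y = sqrt |x| / pi > 1 and 1 < z < y.  Boundedness of the terms and the
    lower bound for H_k give (z w)^(2k) / (2k)! <= (B M / c) (z/y)^(2k) with
    w = (1-h) log M - K, so that exp(z w) <= A M (1 + z w).  With h chosen so
    that z (1-h) = 1 + t, t > 0, the left side grows like M^(1+t). *)
Lemma moment_series_radius_le (H : nat -> R) (x : R) : (forall k, 0 <= H k) ->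
  (forall h : R, 0 < h < 1 -> exists2 c : R, 0 < c & exists K : R, forall M k, (1 < M)%N ->
    0 <= (1 - h) * ln M%:R - K ->
    c * ((1 - h) * ln M%:R - K) ^+ (2 * k) / (M%:R * pi ^+ (2 * k)) <= H k) ->
  cvgn (pseries (fun k => H k / (2 * k)`!%:R) x) -> `|x| <= pi ^+ 2.
Proof.
move=> H0 Hc cx; have p0 := pi_gt0 R; rewrite leNgt; apply/negP => xpi.
have [B HB] : exists B : R, forall k, H k / (2 * k)`!%:R * `|x| ^+ k <= B.
  have cu : cvgn (fun k => H k / (2 * k)`!%:R * x ^+ k).
    by apply/cvg_ex; exists 0; exact: cvg_series_cvg_0 cx.
  have [B [_ hB]] := cvg_seq_bounded cu; exists (B + 1) => k.
  have := hB (B + 1); rewrite ltrDl ltr01 => /(_ isT k I) /=.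
  by rewrite normrM normrX ger0_norm // divr_ge0.
pose y := Num.sqrt `|x| / pi.
have y1 : 1 < y.
  rewrite ltr_pdivlMr // mul1r -(@ltr_pXn2r _ 2) ?nnegrE ?sqrtr_ge0 ?(ltW p0) //.
  by rewrite sqr_sqrtr.
have xE k : `|x| ^+ k = y ^+ (2 * k) * pi ^+ (2 * k).
  by rewrite -exprMn /y divfK ?gt_eqF // exprM sqr_sqrtr.
pose z := (1 + y) / 2; pose t := (z - 1) / 2; pose h := (z - 1) / (2 * z).
have z1 : 1 < z by rewrite /z; lra.
have zy : z < y by rewrite /z; lra.
have z0 : 0 < z by lra.
have y0 : 0 < y by lra.
have t0 : 0 < t by rewrite /t; lra.
have h01 : 0 < h < 1.
  have z2 : 0 < 2 * z by apply: mulr_gt0.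
  by rewrite /h divr_gt0 ?subr_gt0 //= ltr_pdivrMr //; lra.
have zh : z * (1 - h) = 1 + t by rewrite /h /t; field; rewrite gt_eqF.
have [c c0 [K HK]] := Hc h h01.
pose q := (z / y) ^+ 2.
have zy0 : 0 <= z / y by apply: divr_ge0; exact: ltW.
have zy1 : z / y < 1 by rewrite ltr_pdivrMr // mul1r.
have q01 : 0 <= q < 1 by rewrite /q exprn_ge0 //= exprn_ilt1.
have /andP[q0 q1] := q01.
pose A := B / c / (1 - q).
have [v0 v00 hv0] := expR_gt_affine (A * (1 + z * K / t)) (A * (1 + t^-1)).
pose U := (v0 + `|z * K|) / t.
have U0 : 0 <= U by rewrite divr_ge0 ?addr_ge0 // ltW.
pose M := (Num.truncn (expR U)).+2.
have M1 : (1 < M)%N by [].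
have M0R : 0 < M%:R :> R by rewrite ltr0n.
pose u := ln (M%:R : R).
have Mu : M%:R = expR u by rewrite lnK ?posrE.
have Uu : U <= u.
  rewrite -ler_expR -Mu (le_trans (ltW (truncnS_gt _))) // ler_nat; exact: leqnSn.
have u0 : 0 <= u by exact: le_trans Uu.
pose w := (1 - h) * u - K; pose s := z * w; pose v := s - u.
have sE : s = (1 + t) * u - z * K by rewrite /s /w mulrBr mulrA zh.
have vE : v = t * u - z * K by rewrite /v sE; ring.
have vv0 : v0 <= v.
  rewrite vE; have : t * U <= t * u by rewrite ler_pM2l.
  rewrite /U mulrC divfK ?gt_eqF //; have := ler_norm (z * K); lra.
have s0 : 0 <= s by rewrite -[s](subrK u) addr_ge0 // (le_trans v00).
have w0 : 0 <= w by rewrite -(pmulr_rge0 _ z0).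
have terms k : s ^+ (2 * k) / (2 * k)`!%:R <= (B * M%:R / c) * q ^+ k.
  have f0 : 0 < (2 * k)`!%:R :> R by rewrite ltr0n fact_gt0.
  have yk : 0 < y ^+ (2 * k) by rewrite exprn_gt0.
  have zk : 0 < z ^+ (2 * k) by rewrite exprn_gt0.
  have pk : 0 < pi ^+ (2 * k) :> R by rewrite exprn_gt0.
  have hk := HK M k M1 w0; rewrite -/u -/w in hk.
  have hB := HB k; rewrite xE in hB.
  have h3 : c * w ^+ (2 * k) / (M%:R * pi ^+ (2 * k)) / (2 * k)`!%:R
     * (y ^+ (2 * k) * pi ^+ (2 * k)) <= B.
    apply: le_trans hB; rewrite ler_pM2r ?mulr_gt0 // ler_pM2r ?invr_gt0 //.
  rewrite /q -exprM expr_div_n /s exprMn.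
  have -> : z ^+ (2 * k) * w ^+ (2 * k) / (2 * k)`!%:R =
    c * w ^+ (2 * k) / (M%:R * pi ^+ (2 * k)) / (2 * k)`!%:R
     * (y ^+ (2 * k) * pi ^+ (2 * k)) * (M%:R / c * (z ^+ (2 * k) / y ^+ (2 * k))).
    move: pk yk f0 M0R c0; move: (pi ^+ (2 * k) : R) (y ^+ (2 * k)) ((2 * k)`!%:R : R)
      (M%:R : R) => P Y F m /lt0r_neq0 h1 /lt0r_neq0 h2 /lt0r_neq0 h4 /lt0r_neq0 h5 /lt0r_neq0 h6.
    by field; rewrite ?h1 ?h2 ?h4 ?h5 ?h6.
  have -> : B * M%:R / c * (z ^+ (2 * k) / y ^+ (2 * k)) =
    B * (M%:R / c * (z ^+ (2 * k) / y ^+ (2 * k))) by rewrite !mulrA.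
  by rewrite ler_wpM2r // mulr_ge0 // divr_ge0 // ltW.
have := expR_le_even_terms s0 q01 terms; apply/negP; rewrite -ltNge.
have -> : expR s = M%:R * expR v by rewrite Mu -expRD /v addrC subrK.
have -> : B * M%:R / c * (1 + s) / (1 - q) = M%:R * (A * (1 + s)).
  by rewrite /A; ring.
rewrite ltr_pM2l //; apply: le_lt_trans (hv0 v vv0).
rewrite le_eqVlt; apply/orP; left; apply/eqP.
by rewrite sE vE; field; rewrite gt_eqF.
Qed.

End radius.

Theorem corollary1p2 (R : realType) (A0 A1 : R)
    (hA0 : 2^-1 < A0) (hA01 : A0 < A1) (hA1 : A1 < 1)
    (H : nat -> R)
    (hH : forall k : nat, normalized_moment A0 A1 k b @[b --> \oo] --> H k) :
  convergence_radius (fun k : nat => H k / (2 * k)`!%:R) = (pi ^+ 2)%:E.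
Proof.
have A00 : 0 < A0 by apply: lt_trans hA0; rewrite invr_gt0.
have H0 k : 0 <= H k.
  apply: (limit_ge_frequently (hH k)) => N; exists N => //.
  exact: normalized_moment_ge0.
have conv x := moment_series_cvg H0 (limit_moment_le hA01 hH) (x := x).
have le x := moment_series_radius_le H0 (limit_moment_ge A00 hA01 hA1 hH) (x := x).
rewrite /convergence_radius; set S := [set _ | _ in _].
have ub : (ereal_sup S <= (pi ^+ 2)%:E)%E.
  by apply: ge_ereal_sup => _ [x /le xle <-]; rewrite lee_fin.
have lb (r : R) : 0 <= r < pi ^+ 2 -> (r%:E <= ereal_sup S)%E.
  move=> /andP[r0 rpi]; apply: ereal_sup_ubound; exists r; last by rewrite ger0_norm.
  by apply: conv; rewrite ger0_norm.
have p2 : 0 < pi ^+ 2 :> R by rewrite exprn_gt0 // pi_gt0.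
apply/eqP; rewrite eq_le ub /= leNgt; apply/negP => lt.
have l0 := lb 0; rewrite lexx p2 in l0; move: (l0 isT) lt ub lb.
case: (ereal_sup S) => [m| |] //; rewrite lee_fin lte_fin => m0 mpi _ lb.
have := lb ((m + pi ^+ 2) / 2); rewrite lee_fin.
have -> : 0 <= (m + pi ^+ 2) / 2 < pi ^+ 2 by apply/andP; split; lra.
by move=> /(_ isT); lra.
Qed.
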